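(* Let $0<\ell<\infty$, $1\le p<\infty$, $0\le\lambda<1$, $\frac1p+\frac1{p'}=1$, and let $\varphi\in\widetilde W\cap(\mathbf V_{++}\cup\mathbf V_{-+})$ on $(0,\ell]$. The weighted Hardy operator $H_\varphi$ is bounded in the Morrey space $\mathcal{L}^{p,\lambda}([0,\ell])$ if $$\varphi\in\mathbb{Z}_{\frac{\lambda}{p}+\frac1{p'}},\quad\text{or equivalently,}\quad M(\varphi)<\frac{\lambda}{p}+\frac1{p'},$$ and the weighted Hardy operator $\mathcal{H}_\varphi$ is bounded in $\mathcal{L}^{p,\lambda}([0,\ell])$ if $$\varphi\in\mathbb{Z}^{\frac{\lambda-1}{p}},\quad\text{or equivalently,}\quad m(\varphi)>\frac{\lambda}{p}-\frac1p .$$ The condition $m(\varphi)\le\frac{\lambda}{p}+\frac1{p'}$ is necessary for the boundedness of $H_\varphi$ in $\mathcal{L}^{p,\lambda}([0,\ell])$, and the condition $M(\varphi)\ge\frac{\lambda}{p}-\frac1p$ is necessary for the boundedness of $\mathcal{H}_\varphi$ in $\mathcal{L}^{p,\lambda}([0,\ell])$.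
   Context: Morrey space: $\mathcal{L}^{p,\lambda}([0,\ell])$ has norm $\|f\|_{p,\lambda}=\sup_{x\in[0,\ell],\,r>0}\left\{r^{-\lambda}\int_{\{y\in[0,\ell]:|y-x|<r\}}|f(y)|^p\,dy\right\}^{1/p}$. Weighted Hardy operators: $$H_\varphi f(x)=\frac{\varphi(x)}{x}\int_0^x\frac{f(t)\,dt}{\varphi(t)},\qquad \mathcal{H}_\varphi f(x)=\varphi(x)\int_x^\ell\frac{f(t)\,dt}{t\,\varphi(t)}.$$ Classes of functions: a non-negative function $\psi$ is almost increasing if $\psi(x)\le C\psi(y)$ for all $x\le y$, with some constant $C$. $W$ is the class of continuous positive functions on $(0,\ell]$; $W_0$ is the class of $\varphi\in W$ that are almost increasing with $\lim_{x\to0}\varphi(x)=0$; $\widetilde W$ is the class of $\varphi\in W$ such that $x^\alpha\varphi(x)\in W_0$ for some $\alpha=\alpha(\varphi)>0$. For $x,y\in(0,\ell]$ put $x_+=\max(x,y)$, $x_-=\min(x,y)$. $\mathbf V_{++}$ is the class of $\varphi\in W$ such that, for some $C>0$ and all $x\neq y$, $\left|\frac{\varphi(x)-\varphi(y)}{x-y}\right|\le C\frac{\varphi(x_+)}{x_+}$; $\mathbf V_{-+}$ is the class of $\varphi\in W$ such that $\left|\frac{\varphi(x)-\varphi(y)}{x-y}\right|\le C\frac{\varphi(x_-)}{x_+}$. Matuszewska-Orlicz type indices: $$m(\varphi)=\sup_{0<x<1}\frac{\ln\left(\limsup_{h\to0}\frac{\varphi(hx)}{\varphi(h)}\right)}{\ln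 x},\qquad M(\varphi)=\sup_{x>1}\frac{\ln\left(\limsup_{h\to0}\frac{\varphi(hx)}{\varphi(h)}\right)}{\ln x}.$$ Zygmund classes, for $\beta,\gamma\in\mathbb{R}$: $\varphi\in\mathbb{Z}^\beta$ if $\int_0^h\frac{\varphi(x)}{x^{1+\beta}}dx\le c\frac{\varphi(h)}{h^\beta}$, and $\varphi\in\mathbb{Z}_\gamma$ if $\int_h^\ell\frac{\varphi(x)}{x^{1+\gamma}}dx\le c\frac{\varphi(h)}{h^\gamma}$, with $c$ independent of $h\in(0,\ell)$.
   Formalization: The index M(φ) is taken as the infimum over x>1 (the limit as x→∞) instead of the printed supremum, with which the equivalence with the Zygmund condition fails, e.g. for φ(x)=exp(sin(ln x)). *)

(* Defs.v *)
From HB Require Import structures.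
From mathcomp Require Import all_boot all_order all_algebra.
From mathcomp Require Import all_classical all_reals all_analysis.

Set Implicit Arguments.
Unset Strict Implicit.
Unset Printing Implicit Defensive.

Import Order.TTheory GRing.Theory Num.Theory.
Import numFieldNormedType.Exports.

Local Open Scope classical_set_scope.
Local Open Scope ring_scope.

(* Functions on (0, l] or [0, l] are represented by total functions R -> R whose
   values outside the interval (and, for weights, at 0) play no role. *)

Definition morrey_norm (R : realType) (p lam l : R) (f : R -> R) : \bar R :=
  ereal_sup [set z : \bar R | exists x r : R, [/\ x \in `[0, l], 0 < r &
    z = (((r `^ (- lam))%:E *
          \int[lebesgue_measure]_(y in [set y : R | y \in `[0%R, l] /\
                                                   (`|y - x| < r)%R])
            (`|f y| `^ p)%:E) `^ p^-1)%E]].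

Definition morrey (R : realType) (p lam l : R) (f : R -> R) : Prop :=
  measurable_fun (`[0, l] : set R) f /\ (morrey_norm p lam l f < +oo)%E.

Definition hardy (R : realType) (phi f : R -> R) (x : R) : R :=
  phi x / x * \int[lebesgue_measure]_(t in `]0, x]) (f t / phi t).

Definition dual_hardy (R : realType) (l : R) (phi f : R -> R) (x : R) : R :=
  phi x * \int[lebesgue_measure]_(t in `]x, l]) (f t / (t * phi t)).

(* The real-valued integral returns a default value on non-integrable functions,
   so convergence of the defining integral at every x in (0, l] is required
   separately as part of boundedness. *)
Definition hardy_defined (R : realType) (l : R) (phi f : R -> R) : Prop :=
  forall x : R, x \in `]0, l] ->
    (@lebesgue_measure R).-integrable `]0, x] (fun t => (f t / phi t)%:E).

Definition dual_hardy_defined (R : realType) (l : R) (phi f : R -> R) : Prop :=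
  forall x : R, x \in `]0, l] ->
    (@lebesgue_measure R).-integrable `]x, l]
      (fun t => (f t / (t * phi t))%:E).

(* T, with natural domain [defined], is everywhere defined and bounded on the
   Morrey space. *)
Definition morrey_bounded (R : realType) (p lam l : R)
    (defined : (R -> R) -> Prop) (T : (R -> R) -> (R -> R)) : Prop :=
  exists C : R, forall f : R -> R, morrey p lam l f ->
    [/\ defined f, morrey p lam l (T f) &
        (morrey_norm p lam l (T f) <= C%:E * morrey_norm p lam l f)%E].

Definition hardy_bounded (R : realType) (p lam l : R) (phi : R -> R) : Prop :=
  morrey_bounded p lam l (hardy_defined l phi) (hardy phi).

Definition dual_hardy_bounded (R : realType) (p lam l : R) (phi : R -> R) :
    Prop :=
  morrey_bounded p lam l (dual_hardy_defined l phi) (dual_hardy l phi).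

Definition almost_increasing (R : realType) (l : R) (psi : R -> R) : Prop :=
  exists C : R, forall x y : R, x \in `]0, l] -> y \in `]0, l] -> x <= y ->
    psi x <= C * psi y.

Definition class_W (R : realType) (l : R) (phi : R -> R) : Prop :=
  {within `]0, l], continuous phi} /\
  (forall x : R, x \in `]0, l] -> 0 < phi x).

Definition class_W0 (R : realType) (l : R) (phi : R -> R) : Prop :=
  [/\ class_W l phi, almost_increasing l phi & phi x @[x --> 0^'+] --> (0 : R)].

Definition class_Wtilde (R : realType) (l : R) (phi : R -> R) : Prop :=
  class_W l phi /\
  exists2 alpha : R, 0 < alpha & class_W0 l (fun x => x `^ alpha * phi x).

Definition class_Vpp (R : realType) (l : R) (phi : R -> R) : Prop :=
  class_W l phi /\
  exists2 C : R, 0 < C & forall x y : R, x \in `]0, l] -> y \in `]0, l] ->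
    x != y ->
    `|(phi x - phi y) / (x - y)| <= C * (phi (Num.max x y) / Num.max x y).

Definition class_Vmp (R : realType) (l : R) (phi : R -> R) : Prop :=
  class_W l phi /\
  exists2 C : R, 0 < C & forall x y : R, x \in `]0, l] -> y \in `]0, l] ->
    x != y ->
    `|(phi x - phi y) / (x - y)| <= C * (phi (Num.min x y) / Num.max x y).

Definition dilation_limsup (R : realType) (phi : R -> R) (x : R) : \bar R :=
  limf_esup (fun h : R => (phi (h * x) / phi h)%:E) 0^'+.

Definition lower_index (R : realType) (phi : R -> R) : \bar R :=
  ereal_sup [set (lne (dilation_limsup phi x) * ((ln x)^-1)%:E)%E
            | x in `]0, 1[ : set R].

(* The upper index is often printed with a supremum over x > 1. The quantity
   meant is the limit of the quotient as x tends to infinity, which is the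
   infimum because ln (dilation_limsup phi x) is subadditive in ln x. With a
   supremum, phi x = exp (sin (ln x)), which lies between exp (-1) and exp 1,
   would have index 1 although it satisfies zygmund_lower for all gamma > 0. *)
Definition upper_index (R : realType) (phi : R -> R) : \bar R :=
  ereal_inf [set (lne (dilation_limsup phi x) * ((ln x)^-1)%:E)%E
            | x in `]1, +oo[ : set R].

(* Z^beta *)
Definition zygmund_upper (R : realType) (l beta : R) (phi : R -> R) : Prop :=
  exists c : R, forall h : R, h \in `]0, l[ ->
    (\int[lebesgue_measure]_(x in `]0%R, h[) (phi x / x `^ (1 + beta))%:E
      <= (c * (phi h / h `^ beta))%:E)%E.

(* Z_gamma *)
Definition zygmund_lower (R : realType) (l gamma : R) (phi : R -> R) : Prop :=
  exists c : R, forall h : R, h \in `]0, l[ ->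
    (\int[lebesgue_measure]_(x in `]h, l[) (phi x / x `^ (1 + gamma))%:E
      <= (c * (phi h / h `^ gamma))%:E)%E.

(* Main.v *)
Require Import Defs.
From HB Require Import structures.
From mathcomp Require Import all_boot all_order all_algebra.
From mathcomp Require Import all_classical all_reals all_analysis.
From mathcomp Require Import measurable_realfun ring lra.

Import Order.TTheory GRing.Theory Num.Theory.
Import numFieldNormedType.Exports.

Local Open Scope classical_set_scope.
Local Open Scope ring_scope.

Set Implicit Arguments.
Unset Strict Implicit.

(** Both V_{++} and V_{-+} make phi comparable at points of bounded ratio: for
    every Y, its values at x <= y <= Y x differ by a factor bounded in terms of
    Y ([comparable_on_V]). All four claims then pass through two power
    conditions, with b = (lam - 1) / p and a = b + 1:
    - [upper_growth l c phi]: phi y <= C (y / x)^c phi x for x <= y;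
    - [lower_growth l c phi]: phi x <= C (x / y)^c phi y for x <= y.

    Equivalences. Write g x = phi x / x^a and let F h be the integral of g t / t
    over (h, l). The Zygmund condition says F <= C g, and comparability gives
    F h >= F (2 h) + k g (2 h), hence F h >= (1 + k / C) F (2 h). Iterating, g
    is halved when h is multiplied by a large power of 2
    ([geometric_halving]), which says that the upper index is below a. If the
    index is below a, then g decays geometrically along h X^n for some X > 1;
    comparability fills the gaps between these points, so [upper_growth] holds
    for some c < a ([geometric_decay]). Integrating a power of x returns the
    Zygmund condition. The lower index is treated in the same way with 1 / phi
    and the dilation by 1/2.

    Boundedness. Under [upper_growth] with exponent c the operator H_phi is
    dominated by f |-> int_0^1 s^(-c) |f (s x)| ds, and under [lower_growth] the
    dual one by f |-> int_1^oo s^(-c-1) |f (s x)| ds. The dilation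
    f |-> f (s .) multiplies the Morrey norm by at most s^b, so an average of dilations
    with weight k is bounded as soon as k s * s^b is integrable
    ([dilation_mean_morrey]). This is the Minkowski integral inequality, obtained
    from Jensen's inequality for the weight k s * s^b and Tonelli's theorem. For
    the two kernels the integrals are those of s^(b-c) over (0, 1) and of
    s^(b-c-1) over (1, oo); they converge exactly when c < a, resp. c > b.

    Necessity. If the lower index exceeds a, then [lower_growth] holds with some
    c in (a, 1]; the function t^(c-1) lies in the Morrey space but
    t^(c-1) / phi t dominates a multiple of 1 / t, so H_phi is not defined on
    it. If the upper index is below b, then [upper_growth] holds with some
    c < b; the image of the constant 1 under the dual operator dominates a
    multiple of x^c near 0, and this function has infinite Morrey norm. *)

(** * Comparability and power growth *)

(** For positive [g] this is O-regular variation on (0, l], stated for pairs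
    [x <= y <= Y * x]. *)
Definition comparable_on (R : realType) (l : R) (g : R -> R) : Prop :=
  forall Y : R, exists2 K : R, 0 < K & forall x y, 0 < x -> x <= y -> y <= l ->
    y <= Y * x -> g x <= K * g y /\ g y <= K * g x.

(** Equivalently, g x * x^(-c) is almost decreasing on (0, l]. *)
Definition upper_growth (R : realType) (l c : R) (g : R -> R) : Prop :=
  exists2 C : R, 0 < C & forall x y, 0 < x -> x <= y -> y <= l ->
    g y <= C * (y / x) `^ c * g x.

(** Equivalently, g x * x^(-c) is almost increasing on (0, l]. *)
Definition lower_growth (R : realType) (l c : R) (g : R -> R) : Prop :=
  exists2 C : R, 0 < C & forall x y, 0 < x -> x <= y -> y <= l ->
    g x <= C * (x / y) `^ c * g y.

Lemma powR_div (R : realType) (c x y : R) : 0 <= y -> 0 <= x ->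
  (y / x) `^ c = y `^ c / x `^ c.
Proof.
move=> y0 x0; rewrite powRM ?invr_ge0//.
by rewrite -[x^-1]powR_inv1// -powRrM mulN1r powRN.
Qed.

Lemma expr_unbounded (R : realType) (q Y : R) : 1 < q -> exists n, Y <= q ^+ n.
Proof.
move=> q1; have q0 : 0 < q - 1 by rewrite subr_gt0.
exists (Num.truncn (Y / (q - 1))).+1.
set n := _.+1; apply: (@le_trans _ _ (1 + n%:R * (q - 1))).
  have : Y / (q - 1) < n%:R by apply: truncnS_gt.
  by rewrite ltr_pdivrMr// => /ltW; lra.
elim: n => [|n IH]; first by rewrite expr0 mul0r addr0.
rewrite exprS; apply: (le_trans _ (ler_wpM2l _ IH)); last lra.
rewrite -natr1; have : 0 <= n%:R * (q - 1) * (q - 1) :> R.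
  by rewrite !mulr_ge0// ltW.
by lra.
Qed.

(** Comparability within one ratio [rho > 1] propagates: [n] steps of ratio
    [rho] cover the ratio [rho ^+ n], at the price of the constant [K ^+ n]. *)
Lemma comparable_on_chain (R : realType) (l rho K : R) (g : R -> R) :
  1 < rho -> 0 < K ->
  (forall x y, 0 < x -> x <= y -> y <= l -> y <= rho * x ->
    g x <= K * g y /\ g y <= K * g x) ->
  comparable_on l g.
Proof.
move=> rho1 K0 H Y; have [n Yn] := expr_unbounded Y rho1.
have r0 : 0 < rho by lra.
exists (K ^+ n); first exact: exprn_gt0.
move=> x y x0 xy yl yY.
have {Yn yY} : y <= rho ^+ n * x by apply: (le_trans yY); rewrite ler_pM2r.
elim: n x x0 y xy yl => [|n IH] x x0 y xy yl yn.
  have -> : y = x by apply: le_anti; rewrite xy (le_trans yn)// mul1r.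
  by rewrite expr0 mul1r.
(* An intermediate point within [rho ^+ n] of [x] and within [rho] of [y]. *)
pose z := Num.max x (y / rho).
have zy : z <= y by rewrite ge_max xy/= ler_pdivrMr//; nra.
have xz : x <= z by rewrite le_max lexx.
have z0 : 0 < z by lra.
have zn : z <= rho ^+ n * x.
  rewrite ge_max ler_pdivrMr// mulrAC -exprSr yn andbT.
  have : 1 <= rho ^+ n by apply: exprn_ege1; lra.
  by nra.
have yz : y <= rho * z.
  by rewrite mulrC -ler_pdivrMr// le_max lexx orbT.
have [h1 h2] := IH x x0 z xz (le_trans zy yl) zn.
have [h3 h4] := H z y z0 zy yl yz.
have Kn : 0 < K ^+ n by rewrite exprn_gt0.
split.
  by apply: (le_trans h1); rewrite exprSr -mulrA ler_pM2l.
by apply: (le_trans h4); rewrite exprS -mulrA ler_pM2l.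
Qed.

(** For [y <= (1 + 1 / (2 C)) x] either class bounds the increment of [phi] by
    half of one of the two values, and then the two values differ by a factor of
    at most 2. *)
Lemma comparable_on_V (R : realType) (l : R) (phi : R -> R) :
  class_Vpp l phi \/ class_Vmp l phi -> comparable_on l phi.
Proof.
have half (x y u v C : R) : 0 < C -> 0 < x -> x < y ->
    y <= (1 + (2 * C)^-1) * x -> 0 < v ->
    `|(u / (x - y))| <= C * (v / y) -> `|u| <= v / 2.
  move=> C0 x0 xy yx v0; have y0 := lt_trans x0 xy.
  have C2 : 0 < (2 * C)^-1 by rewrite invr_gt0; lra.
  rewrite normf_div (ltr0_norm (_ : x - y < 0)); last by lra.
  rewrite opprB ler_pdivrMr; last by lra.
  move=> /le_trans; apply.
  have h : C * (y - x) <= y / 2.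
    apply: (@le_trans _ _ (C * ((2 * C)^-1 * y))).
      by rewrite ler_pM2l//; nra.
    by rewrite le_eqVlt; apply/orP; left; apply/eqP; field; lra.
  rewrite (_ : C * (v / y) * (y - x) = (v / y) * (C * (y - x))); last by ring.
  apply: (@le_trans _ _ (v / y * (y / 2))); first by rewrite ler_pM2l// divr_gt0.
  by rewrite le_eqVlt; apply/orP; left; apply/eqP; field; lra.
have close (u v w : R) : `|u - v| <= w / 2 -> w = u \/ w = v -> 0 < u -> 0 < v ->
    u <= 2 * v /\ v <= 2 * u.
  by rewrite ler_norml => /andP[? ?] [?|?] ? ?; split; lra.
have itv (x y : R) : 0 < x -> x <= y -> y <= l ->
    x \in `]0, l] /\ y \in `]0, l].
  by move=> x0 xy yl; rewrite !in_itv/= yl x0 (lt_le_trans x0 xy) (le_trans xy).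
move=> [] [[_ pos] [C C0 H]];
  apply: (@comparable_on_chain _ l (1 + (2 * C)^-1) 2) => //;
  try (by rewrite ltrDl invr_gt0; lra);
  move=> x y x0 xy yl yx; have [xl yl'] := itv x y x0 xy yl;
  have px := pos _ xl; have py := pos _ yl';
  (move: xy; rewrite le_eqVlt => /predU1P[<-|xy]; first by split; lra);
  have := H x y xl yl' (negbT (lt_eqF xy)).
- rewrite (max_r (ltW xy)) => /half h.
  by apply: (close _ _ (phi y)) => //; [exact: h|right].
- rewrite (max_r (ltW xy)) (min_l (ltW xy)) => /half h.
  by apply: (close _ _ (phi x)) => //; [exact: h|left].
Qed.

Lemma comparable_on_powR (R : realType) (l c : R) (g : R -> R) :
  (forall x, 0 < x -> x <= l -> 0 < g x) -> comparable_on l g ->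
  comparable_on l (fun x => g x * x `^ c).
Proof.
move=> g0 H Y; have [K K0 {}H] := H Y.
pose D := Num.max 1 Y `^ `|c|.
have Y1 : 1 <= Num.max 1 Y by rewrite le_max lexx.
have D0 : 0 < D by rewrite powR_gt0//; lra.
exists (K * D); first exact: mulr_gt0.
move=> x y x0 xy yl yY; have [h1 h2] := H x y x0 xy yl yY.
have y0 : 0 < y by lra.
have pw e : (y / x) `^ e <= Num.max 1 Y `^ `|e|.
  have yx1 : 1 <= y / x by rewrite ler_pdivlMr// mul1r.
  apply: (@le_trans _ _ ((y / x) `^ `|e|)).
    by apply: ler_powR => //; exact: ler_norm.
  apply: ge0_ler_powR; rewrite ?nnegrE//; try lra.
  by rewrite ler_pdivrMr// (le_trans yY)// ler_pM2r// le_max lexx orbT.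
have yE e : y `^ e = (y / x) `^ e * x `^ e.
  by rewrite -powRM ?divr_ge0 ?ltW// -mulrA mulVf ?mulr1//; lra.
have py : y `^ c <= D * x `^ c by rewrite yE ler_pM2r ?powR_gt0//.
have px : x `^ c <= D * y `^ c.
  have := pw (- c); rewrite normrN -/D => h.
  have e : x `^ c = (y / x) `^ (- c) * y `^ c.
    by rewrite yE powRN mulKf// gt_eqF// powR_gt0// divr_gt0.
  by rewrite {1}e ler_pM2r ?powR_gt0.
have p0 e : 0 <= x `^ e := powR_ge0 _ _.
have q0 e : 0 <= y `^ e := powR_ge0 _ _.
have gx : 0 < g x by apply: g0 => //; lra.
have gy : 0 < g y by apply: g0 => //; lra.
split; rewrite mulrACA.
  by apply: ler_pM => //; exact: ltW.
by apply: ler_pM => //; exact: ltW.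
Qed.

Lemma comparable_on_inv (R : realType) (l : R) (g : R -> R) :
  (forall x, 0 < x -> x <= l -> 0 < g x) -> comparable_on l g ->
  comparable_on l (fun x => (g x)^-1).
Proof.
move=> g0 H Y; have [K K0 {}H] := H Y.
exists K => // x y x0 xy yl yY; have [h1 h2] := H x y x0 xy yl yY.
have gx : 0 < g x by apply: g0 => //; lra.
have gy : 0 < g y by apply: g0 => //; lra.
by split; rewrite -ler_pdivrMl// -invfM lef_pV2 ?posrE// mulr_gt0.
Qed.

(** The decay rate [e] solves [X `^ e = q^-1], so that G x = g x * x^e does not
    increase along h, h X, h X^2, ... as long as the points stay below [h1]. Two
    consecutive points, and two points of [h1, l], have a ratio at most
    max (X, l / h1), so comparability controls what happens in between. *)
Lemma geometric_decay (R : realType) (l X q h1 : R) (g : R -> R) :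
  0 < l -> (forall x, 0 < x -> x <= l -> 0 < g x) -> comparable_on l g ->
  1 < X -> 0 < q -> q < 1 -> 0 < h1 ->
  (forall h, 0 < h -> h < h1 -> h * X <= l -> g (h * X) <= q * g h) ->
  exists2 e : R, 0 < e & upper_growth l (- e) g.
Proof.
move=> l0 g0 cg X1 q0 q1 h10 H.
have lnX : 0 < ln X by rewrite ln_gt0.
have lnq : ln q < 0 by rewrite ln_lt0// q0.
pose e := - ln q / ln X.
have e0 : 0 < e by rewrite divr_gt0// oppr_gt0.
have Xe : X `^ e = q^-1.
  rewrite /powR gt_eqF; last by lra.
  by rewrite /e divfK ?gt_eqF// expRN lnK.
exists e => //; pose G x := g x * x `^ e.
have HG h : 0 < h -> h < h1 -> h * X <= l -> G (h * X) <= G h.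
  move=> h0 hh hX; rewrite /G powRM; [|exact: ltW|lra].
  have := H h h0 hh hX; rewrite -(ler_pM2r (powR_gt0 e h0)).
  rewrite Xe -(@ler_pM2r _ q^-1) ?invr_gt0// => h'.
  rewrite mulrA; apply: (le_trans h'); rewrite le_eqVlt; apply/orP; left.
  by apply/eqP; field; lra.
pose Y := Num.max X (l / h1).
have XY : X <= Y by rewrite le_max lexx.
have [C C0 HC] := comparable_on_powR e g0 cg Y.
exists C => // x y x0 xy yl.
have y0 : 0 < y by lra.
have h : G y <= C * G x -> g y <= C * (y / x) `^ (- e) * g x.
  rewrite /G -ler_pdivlMr ?powR_gt0// => /le_trans; apply.
  rewrite le_eqVlt; apply/orP; left; apply/eqP.
  rewrite powRN powR_div ?ltW//.
  by field; rewrite !gt_eqF ?powR_gt0.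
apply: h.
(* Induction on n for y <= Y X^n x: beyond Y x the point x lies below h1,
   and the decay replaces x by x X. *)
have [n Yn] := expr_unbounded (y / x / Y) X1.
have {Yn} : y <= Y * X ^+ n * x.
  move: Yn; rewrite !ler_pdivrMr//; last by lra.
  by rewrite [X ^+ n * Y]mulrC.
elim: n x x0 xy => [|n IH] x x0 xy yn.
  by apply: (HC x y x0 xy yl _).2; move: yn; rewrite expr0 mulr1.
have [yY|Yy] := leP y (Y * x); first exact: (HC x y x0 xy yl yY).2.
have xX : x * X <= y by nra.
have xh : x < h1.
  have : Y * x < l by lra.
  have : l / h1 * x <= Y * x by rewrite ler_pM2r// le_max lexx orbT.
  move=> h /(le_lt_trans h); rewrite mulrAC ltr_pdivrMr// ltr_pM2l//.
have Xx : X * x <= y by rewrite mulrC.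
apply: (@le_trans _ _ (C * G (x * X))).
  apply: IH => //; first by rewrite mulr_gt0//; lra.
  by move: yn; rewrite exprS; lra.
by rewrite ler_pM2l//; apply: HG => //; lra.
Qed.

Lemma upper_growth_powR (R : realType) (l c d : R) (g : R -> R) :
  upper_growth l c (fun x => g x * x `^ d) -> upper_growth l (c - d) g.
Proof.
move=> [C C0 H]; exists C => // x y x0 xy yl; have y0 : 0 < y by lra.
have yx0 : 0 < y / x by rewrite divr_gt0.
have := H x y x0 xy yl; rewrite -ler_pdivlMr ?powR_gt0// => /le_trans; apply.
rewrite le_eqVlt; apply/orP; left; apply/eqP.
rewrite powRD ?(gt_eqF yx0) ?implybT// powRN (powR_div d) ?ltW//.
by field; rewrite !gt_eqF ?powR_gt0.
Qed.

(** Growth from below is growth from above of the reciprocal; this transfers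
    [geometric_decay] from the upper to the lower index. *)
Lemma lower_growth_inv (R : realType) (l c : R) (g : R -> R) :
  (forall x, 0 < x -> x <= l -> 0 < g x) ->
  upper_growth l c (fun x => (g x)^-1) -> lower_growth l (- c) g.
Proof.
move=> g0 [C C0 H]; exists C => // x y x0 xy yl; have y0 : 0 < y by lra.
have gx : 0 < g x by apply: g0 => //; lra.
have gy : 0 < g y by apply: g0 => //; lra.
have := H x y x0 xy yl.
rewrite -ler_pdivrMl ?mulr_gt0 ?powR_gt0 ?divr_gt0// -invfM => h.
have {}h : g x <= C * (y / x) `^ c * g y.
  by rewrite -lef_pV2 ?posrE ?mulr_gt0 ?powR_gt0 ?divr_gt0.
apply: (le_trans h); rewrite ler_pM2r// ler_pM2l//.
rewrite le_eqVlt; apply/orP; left; apply/eqP.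
by rewrite powRN !powR_div ?ltW// invf_div.
Qed.

Lemma lower_growthW (R : realType) (l c d : R) (g : R -> R) :
  (forall x, 0 < x -> x <= l -> 0 < g x) ->
  d <= c -> lower_growth l c g -> lower_growth l d g.
Proof.
move=> g0 dc [C C0 H]; exists C => // x y x0 xy yl; have y0 : 0 < y by lra.
have gy : 0 < g y by apply: g0 => //; lra.
apply: (le_trans (H x y x0 xy yl)); rewrite ler_pM2r// ler_pM2l//.
by apply: ger_powR => //; rewrite divr_gt0//= ler_pdivrMr// mul1r.
Qed.

(** * Matuszewska-Orlicz indices and power growth *)

(** The strict inequality leaves room for a factor [q < 1], which is the gain
    needed for a geometric iteration. *)
Lemma dilation_limsup_lt (R : realType) (phi : R -> R) (X c : R) : 0 < c ->
  (dilation_limsup phi X < c%:E)%E ->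
  exists q d, [/\ 0 < q, q < 1, 0 < d &
    forall h, 0 < h -> h < d -> phi (h * X) / phi h <= q * c].
Proof.
move=> c0 /ereal_inf_lt[_ [V /= V0 <-] sc].
have [s [s0 sc' hs]] : exists s, [/\ 0 < s, s < c &
    (ereal_sup [set (phi (h * X) / phi h)%:E | h in V] <= s%:E)%E].
  move: sc; set S := ereal_sup _.
  case: S => [s||]//=; rewrite ?lte_fin => sc.
    exists (Num.max s (c / 2)); split.
    - by rewrite lt_max; apply/orP; right; lra.
    - by rewrite gt_max sc/=; lra.
    - by rewrite lee_fin le_max lexx.
  by exists (c / 2); rewrite leNye; split => //; lra.
move: V0 => /nbhs_right0P => -[e /= e0 Ve].
exists (s / c), e; split => //.
- by rewrite divr_gt0.
- by rewrite ltr_pdivrMr// mul1r.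
move=> h h0 he; rewrite divfK ?gt_eqF//.
have Vh : V h.
  have := Ve h; rewrite /= sub0r normrN gtr0_norm// add0r; exact.
rewrite -lee_fin; apply: le_trans hs.
by apply: ereal_sup_ubound; exists h.
Qed.

Lemma dilation_limsup_le (R : realType) (phi : R -> R) (X c d : R) : 0 < d ->
  (forall h, 0 < h -> h < d -> phi (h * X) / phi h <= c) ->
  (dilation_limsup phi X <= c%:E)%E.
Proof.
move=> d0 H.
apply: (@le_trans _ _ (ereal_sup [set (phi (h * X) / phi h)%:E | h in `]0, d[])).
  apply: ereal_inf_lbound; exists `]0, d[%classic => //=.
  near=> h; rewrite /= in_itv/=; apply/andP; split; near: h.
    exact: nbhs_right_gt.
  exact: nbhs_right_lt.
apply: ge_ereal_sup => z [h /=]; rewrite in_itv/= => /andP[h0 hd] <-.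
by rewrite lee_fin H.
Unshelve. all: by end_near. Qed.

Lemma upper_index_lt (R : realType) (phi : R -> R) (c : R) :
  (upper_index phi < c%:E)%E ->
  exists2 X, 1 < X & (dilation_limsup phi X < (X `^ c)%:E)%E.
Proof.
move=> /ereal_inf_lt[z [X /=]]; rewrite in_itv/= andbT => X1 <- H.
exists X => //; have X0 : 0 < X by lra.
have lnX : 0 < ln X by rewrite ln_gt0.
move: H; case: (dilation_limsup phi X) => [s||] H.
- rewrite lte_fin; have [s0|s0] := leP s 0; first exact: le_lt_trans (powR_gt0 _ _).
  move: H; rewrite lne_EFin// -EFinM lte_fin ltr_pdivrMr// -ln_powR.
  by rewrite ltr_ln// posrE powR_gt0.
- by move: H; rewrite /= gt0_mulye// lte_fin invr_gt0.
- by rewrite ltNyr.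
Qed.

Lemma lower_index_gt (R : realType) (phi : R -> R) (c : R) :
  (c%:E < lower_index phi)%E ->
  exists X, [/\ 0 < X, X < 1 & (dilation_limsup phi X < (X `^ c)%:E)%E].
Proof.
move=> /ereal_sup_gt[z [X /=]]; rewrite in_itv/= => /andP[X0 X1] <- H.
exists X; split => //.
have lnX : ln X < 0 by rewrite ln_lt0// X0.
move: H; case: (dilation_limsup phi X) => [s||] H.
- rewrite lte_fin; have [s0|s0] := leP s 0; first exact: le_lt_trans (powR_gt0 _ _).
  move: H; rewrite lne_EFin// -EFinM lte_fin ltr_ndivlMr// -ln_powR.
  by rewrite ltr_ln// posrE powR_gt0.
- by move: H; rewrite /= lt0_mulye// lte_fin invr_lt0.
- by rewrite ltNyr.
Qed.

Lemma le_lne_EFin (R : realType) (x : \bar R) (c : R) : 0 < c ->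
  (x <= c%:E)%E -> (lne x <= (ln c)%:E)%E.
Proof.
move=> c0; case: x => [s||] h; [|by []|by rewrite /= leNye].
have [s0|s0] := leP s 0; first by rewrite le0_lneNy ?lee_fin// leNye.
by rewrite lne_EFin// lee_fin ler_ln ?posrE// -lee_fin.
Qed.

Lemma lt_upper_index (R : realType) (phi : R -> R) (X c q d : R) :
  1 < X -> 0 < q -> q < 1 -> 0 < d ->
  (forall h, 0 < h -> h < d -> phi (h * X) / phi h <= q * X `^ c) ->
  (upper_index phi < c%:E)%E.
Proof.
move=> X1 q0 q1 d0 H; have X0 : 0 < X by lra.
have lnX : 0 < ln X by rewrite ln_gt0.
have := dilation_limsup_le d0 H => /le_lne_EFin h.
apply: (@le_lt_trans _ _ (lne (dilation_limsup phi X) * ((ln X)^-1)%:E)%E).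
  by apply: ereal_inf_lbound; exists X => //=; rewrite in_itv/= X1.
apply: (@le_lt_trans _ _ ((ln (q * X `^ c))%:E * ((ln X)^-1)%:E)%E).
  apply: lee_wpmul2r; first by rewrite lee_fin invr_ge0 ltW.
  by apply: h; rewrite mulr_gt0 ?powR_gt0.
rewrite -EFinM lte_fin ltr_pdivrMr// -ln_powR ltr_ln ?posrE ?mulr_gt0 ?powR_gt0//.
by rewrite gtr_pMl// powR_gt0.
Qed.

Lemma gt_lower_index (R : realType) (phi : R -> R) (X c q d : R) :
  0 < X -> X < 1 -> 0 < q -> q < 1 -> 0 < d ->
  (forall h, 0 < h -> h < d -> phi (h * X) / phi h <= q * X `^ c) ->
  (c%:E < lower_index phi)%E.
Proof.
move=> X0 X1 q0 q1 d0 H.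
have lnX : ln X < 0 by rewrite ln_lt0// X0.
have := dilation_limsup_le d0 H => /le_lne_EFin h.
apply: (@lt_le_trans _ _ (lne (dilation_limsup phi X) * ((ln X)^-1)%:E)%E); last first.
  by apply: ereal_sup_ubound; exists X => //=; rewrite in_itv/= X0.
apply: (@lt_le_trans _ _ ((ln (q * X `^ c))%:E * ((ln X)^-1)%:E)%E); last first.
  rewrite -[(ln X)^-1]opprK EFinN !muleN leeN2.
  apply: lee_wpmul2r; first by rewrite lee_fin oppr_ge0 invr_le0 ltW.
  by apply: h; rewrite mulr_gt0 ?powR_gt0.
rewrite -EFinM lte_fin ltr_ndivlMr// -ln_powR ltr_ln ?posrE ?mulr_gt0 ?powR_gt0//.
by rewrite gtr_pMl// powR_gt0.
Qed.

(** The infimum in the index is attained up to an arbitrarily small error at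
    some X > 1, and a single such X suffices for [geometric_decay], applied to
    phi x * x^(-a). *)
Lemma upper_growth_index (R : realType) (l a : R) (phi : R -> R) : 0 < l ->
  (forall x, 0 < x -> x <= l -> 0 < phi x) -> comparable_on l phi ->
  (upper_index phi < a%:E)%E ->
  exists2 c, c < a & upper_growth l c phi.
Proof.
move=> l0 pos cphi /upper_index_lt[X X1 /(dilation_limsup_lt (powR_gt0 _ _))].
have X0 : 0 < X by lra.
move=> /(_ X0)[q [d [q0 q1 d0 H]]].
have pos' x : 0 < x -> x <= l -> 0 < phi x * x `^ (- a).
  by move=> x0 xl; rewrite mulr_gt0 ?powR_gt0 ?pos.
have [e e0 ge] : exists2 e, 0 < e & upper_growth l (- e) (fun x => phi x * x `^ (- a)).
  apply: (@geometric_decay _ l X q d) => //; first exact: comparable_on_powR.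
  move=> h h0 hd hl; have hl' : h <= l by apply: le_trans hl; rewrite ler_peMr// ltW.
  have := H h h0 hd; rewrite ler_pdivrMr ?pos// => h'.
  rewrite /= !powRN (powRM _ (ltW h0) (ltW X0)) ler_pdivrMr ?mulr_gt0 ?powR_gt0//.
  apply: (le_trans h'); rewrite le_eqVlt; apply/orP; left; apply/eqP.
  by field; rewrite !gt_eqF ?powR_gt0.
exists (- e + a); first by lra.
by rewrite -[a]opprK; exact: upper_growth_powR.
Qed.

(** Here the index provides X < 1. Read from h X to h, the inequality is a decay
    of the reciprocal of phi x * x^(-b) under dilation by [X^-1 > 1]. *)
Lemma lower_growth_index (R : realType) (l b : R) (phi : R -> R) : 0 < l ->
  (forall x, 0 < x -> x <= l -> 0 < phi x) -> comparable_on l phi ->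
  (b%:E < lower_index phi)%E ->
  exists2 c, b < c & lower_growth l c phi.
Proof.
move=> l0 pos cphi /lower_index_gt[X [X0 X1]] /(dilation_limsup_lt (powR_gt0 _ X0)).
move=> [q [d [q0 q1 d0 H]]].
have pos' x : 0 < x -> x <= l -> 0 < phi x * x `^ (- b).
  by move=> x0 xl; rewrite mulr_gt0 ?powR_gt0 ?pos.
have [e e0 ge] : exists2 e, 0 < e &
    upper_growth l (- e) (fun x => (phi x * x `^ (- b))^-1).
  apply: (@geometric_decay _ l X^-1 q (d * X)) => //.
  - by move=> x x0 xl; rewrite invr_gt0 pos'.
  - by apply: comparable_on_inv => //; exact: comparable_on_powR.
  - by rewrite invf_gt1.
  - exact: mulr_gt0.
  move=> h h0; rewrite -ltr_pdivrMr// => hd hl.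
  have k0 : 0 < h / X by rewrite divr_gt0.
  have := H _ k0 hd; rewrite divfK ?gt_eqF//.
  have hk : h <= h / X by rewrite ler_pdivlMr// ler_piMr ?ltW.
  have hl' := le_trans hk hl.
  rewrite ler_pdivrMr ?pos// => h'.
  rewrite /= -ler_pdivrMl// -invfM lef_pV2 ?posrE ?mulr_gt0 ?powR_gt0 ?pos//.
  rewrite (powR_div _ (ltW h0) (ltW X0)) !powRN.
  rewrite ler_pdivrMr ?powR_gt0//; apply: (le_trans h').
  rewrite le_eqVlt; apply/orP; left; apply/eqP.
  by field; rewrite !gt_eqF ?powR_gt0.
exists (e + b); first by lra.
have [C C0 {}ge] := lower_growth_inv pos' ge.
exists C => // x y x0 xy yl; have y0 : 0 < y by lra.
have xy0 : 0 < x / y by rewrite divr_gt0.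
have := ge x y x0 xy yl; rewrite -ler_pdivlMr ?powR_gt0// => /le_trans; apply.
rewrite le_eqVlt; apply/orP; left; apply/eqP.
rewrite opprK powRD ?(gt_eqF xy0) ?implybT// (powR_div b) ?ltW// !powRN.
by field; rewrite !gt_eqF ?powR_gt0.
Qed.

(** * Dilations of the Lebesgue integral and weighted Jensen inequality *)

(** The image of the Lebesgue measure under x |-> s x, scaled by [s], gives
    intervals their length, hence is the Lebesgue measure. *)
Lemma ge0_integral_dilation (R : realType) (s : R) (f : R -> \bar R) :
  0 < s -> measurable_fun [set: R] f -> (forall x, (0 <= f x)%E) ->
  (\int[lebesgue_measure]_x f x =
   s%:E * \int[lebesgue_measure]_x f (s * x)%R)%E.
Proof.
move=> s0 mf f0.
have ms : measurable_fun setT ( *%R s : R -> measurableTypeR R).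
  exact: (mulrl_measurable s).
pose nu : {measure set (measurableTypeR R) -> \bar R} :=
  mscale (NngNum (ltW s0))
    (pushforward lebesgue_measure ( *%R s : R -> measurableTypeR R)).
transitivity (\int[nu ms]_x f x)%E.
  apply: eq_measure_integral => /= A mA _.
  apply: (@lebesgue_measure_unique R (nu ms)) => // _ [[a b]] _ <-.
  change (lebesgue_measure `]a, b]%classic =
    s%:E * lebesgue_measure ( *%R s @^-1` `]a, b]%classic))%E.
  rewrite (_ : _ @^-1` _ = `]a / s, b / s]%classic); last first.
    apply/seteqP; split => x /=;
      by rewrite !in_itv/= ltr_pdivrMr// ler_pdivlMr// ![x * s]mulrC.
  rewrite /= !lebesgue_measure_itv/= !lte_fin ltr_pM2r ?invr_gt0//.
  case: ifPn => _; last by rewrite mule0.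
  by rewrite -!EFinB -EFinM -mulrBl mulrC divfK ?gt_eqF.
rewrite /nu ge0_integral_mscale//=; congr (_ * _)%E.
by rewrite ge0_integral_pushforward.
Qed.

(** Young's inequality with second factor 1. *)
Lemma bernoulli_powR (R : realType) (p t : R) : 1 <= p -> 0 <= t ->
  t <= t `^ p / p + (1 - p^-1).
Proof.
move=> p1 t0; have p0 : 0 < p by lra.
move: p1; rewrite le_eqVlt => /predU1P[<-|p1].
  by rewrite powRr1// invr1 mulr1 subrr addr0.
have q0 : 0 < 1 - p^-1 by rewrite subr_gt0 invf_lt1.
have := @conjugate_powR _ t 1 p (1 - p^-1)^-1 t0 ler01 p0.
by rewrite invr_gt0 invrK powR1 mulr1 mul1r => /(_ q0); apply; ring.
Qed.

(** Integrating [bernoulli_powR] for t = v / c against w bounds the integral of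
    v w for every c > 0. The choice c = J / A, where J is that integral, makes
    the bound the required one. *)
Lemma weighted_jensen (R : realType) (p A : R) (v w : R -> R) :
  1 <= p -> 0 < A ->
  measurable_fun [set: R] v -> measurable_fun [set: R] w ->
  (forall x, 0 <= v x) -> (forall x, 0 <= w x) ->
  (\int[lebesgue_measure]_x (w x)%:E <= A%:E)%E ->
  ((\int[lebesgue_measure]_x (v x * w x)%:E) `^ p <=
   (A `^ (p - 1))%:E * \int[lebesgue_measure]_x (v x `^ p * w x)%:E)%E.
Proof.
move=> p1 A0 mv mw v0 w0 wA; have p0 : 0 < p by lra.
set J := (\int[_]_x _)%E; set B := (\int[_]_x (_ `^ p * _)%:E)%E.
have mvp : measurable_fun [set: R] (fun x => v x `^ p).
  exact: (measurableT_comp (measurable_powR p)).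
have B0 : (0 <= B)%E.
  by apply: integral_ge0 => x _; rewrite lee_fin mulr_ge0 ?powR_ge0.
have J0 : (0 <= J)%E by apply: integral_ge0 => x _; rewrite lee_fin mulr_ge0.
have key c : 0 < c ->
    (J <= (c `^ (1 - p) / p)%:E * B + ((1 - p^-1) * c * A)%:E)%E.
  move=> c0.
  have q0 : 0 <= 1 - p^-1 by rewrite subr_ge0 invf_le1.
  have k0 : 0 <= c `^ (1 - p) / p by rewrite divr_ge0 ?powR_ge0// ltW.
  have k1 : 0 <= (1 - p^-1) * c by rewrite mulr_ge0// ltW.
  pose f1 x := (v x `^ p * w x)%:E; pose f2 x := (w x)%:E.
  have n1 x : setT x -> (0 <= f1 x)%E by rewrite lee_fin mulr_ge0 ?powR_ge0.
  have n2 x : setT x -> (0 <= f2 x)%E by rewrite lee_fin.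
  have m1 : measurable_fun [set: R] f1.
    by apply/measurable_EFinP; exact: measurable_funM.
  have m2 : measurable_fun [set: R] f2 by exact/measurable_EFinP.
  have n1' x : setT x -> (0 <= (c `^ (1 - p) / p)%:E * f1 x)%E.
    by move=> h; apply: mule_ge0; [rewrite lee_fin|exact: n1].
  have n2' x : setT x -> (0 <= ((1 - p^-1) * c)%:E * f2 x)%E.
    by move=> h; apply: mule_ge0; [rewrite lee_fin|exact: n2].
  have m1' := measurable_funeM (c `^ (1 - p) / p)%:E m1.
  have m2' := measurable_funeM ((1 - p^-1) * c)%:E m2.
  apply: (@le_trans _ _ (\int[lebesgue_measure]_x
      ((c `^ (1 - p) / p)%:E * f1 x + ((1 - p^-1) * c)%:E * f2 x))%E).
    apply: ge0_le_integral => //.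
    - by move=> x _; rewrite lee_fin mulr_ge0.
    - by apply/measurable_EFinP; exact: measurable_funM.
    - exact: emeasurable_funD.
    - move=> x _; rewrite -!EFinM -EFinD lee_fin mulrA -mulrDl.
      apply: ler_wpM2r => //.
      have := bernoulli_powR p1 (divr_ge0 (v0 x) (ltW c0)).
      rewrite ler_pdivrMr// (powR_div _ (v0 x) (ltW c0)) => /le_trans; apply.
      rewrite le_eqVlt; apply/orP; left; apply/eqP.
      rewrite powRD ?(gt_eqF c0) ?implybT// powRr1 ?powRN ?ltW//.
      by field; rewrite !gt_eqF ?powR_gt0.
  rewrite ge0_integralD//.
  rewrite ge0_integralZl_EFin// ge0_integralZl_EFin//.
  by apply: leeD2l; rewrite [leRHS]EFinM; apply: lee_wpmul2l.
move: (B) B0 key => [b||]//; last first.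
  by move=> _ _; rewrite gt0_muley ?lte_fin ?powR_gt0// leey.
rewrite lee_fin => b0 key.
move: (J) J0 key => [j||]//; last by move=> _ /(_ 1 ltr01); rewrite -EFinM -EFinD leye_eq.
rewrite lee_fin le_eqVlt => /predU1P[<-|j0] key.
  by rewrite poweR0r ?gt_eqF// -EFinM lee_fin mulr_ge0 ?powR_ge0.
(* The mean of [v] for the weight [w], with the mass of [w] replaced by its
   bound [A]. *)
have c0 : 0 < j / A by rewrite divr_gt0.
have := key _ c0; rewrite -EFinM -EFinD lee_fin -mulrA divfK ?gt_eqF// => h.
have {}h : j <= (j / A) `^ (1 - p) * b.
  have h2 : j / p <= (j / A) `^ (1 - p) * b / p.
    have -> : j / p = j - (1 - p^-1) * j by ring.
    rewrite lerBlDr; apply: (le_trans h); rewrite lerD2r.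
    by rewrite le_eqVlt; apply/orP; left; apply/eqP; ring.
  by move: h2; rewrite ler_pM2r ?invr_gt0.
rewrite poweR_EFin -EFinM lee_fin -(mulr_powRB1 (ltW j0) p0).
have -> : j `^ (p - 1) = (j / A) `^ (p - 1) * A `^ (p - 1).
  by rewrite powR_div ?divfK ?gt_eqF ?powR_gt0// ltW.
rewrite mulrA mulrC ler_pM2l ?powR_gt0//.
rewrite -ler_pdivlMr ?powR_gt0//; apply: (le_trans h).
by rewrite -powRN opprB mulrC.
Qed.

(** * Averages of dilations on Morrey spaces *)

(** The superposition of the dilates u (s .) with weight [k]; it is [+oo] where
    the integral diverges. *)
Definition dilation_mean (R : realType) (k u : R -> R) (x : R) : \bar R :=
  (\int[lebesgue_measure]_s (k s * u (s * x))%:E)%E.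

Section dilation_mean.
Context (R : realType) (k u : R -> R).
Hypothesis k_ge0 : forall s, 0 <= k s.
Hypothesis u_ge0 : forall s, 0 <= u s.
Hypothesis mk : measurable_fun [set: R] k.
Hypothesis mu : measurable_fun [set: R] u.

Let measurable_mulsnd_fst :
  measurable_fun [set: R * R] (fun z : R * R => z.2 * z.1).
Proof. exact: measurable_funM measurable_snd measurable_fst. Qed.

Lemma measurable_dilation_mean : measurable_fun [set: R] (dilation_mean k u).
Proof.
pose f (z : R * R) := (k z.2 * u (z.2 * z.1))%:E.
apply: (@measurable_fun_fubini_tonelli_F _ _ _ _ R lebesgue_measure f).
- apply/measurable_EFinP; apply: measurable_funM.
    exact: (measurableT_comp mk measurable_snd).
  exact: (measurableT_comp mu measurable_mulsnd_fst).
- by move=> z; rewrite lee_fin mulr_ge0.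
Qed.

Lemma dilation_mean_ge0 x : (0 <= dilation_mean k u x)%E.
Proof. by apply: integral_ge0 => s _; rewrite lee_fin mulr_ge0. Qed.

(** The dilate u (s .) has Morrey norm at most s^((lam - 1) / p) times that of u: the
    change of variables contributes 1 / s and the radius of the ball becomes
    s r. Jensen's inequality is applied to k s * u (s y) = v y s * w s with the
    weight w s = k s * s^((lam - 1) / p) and v y s = u (s y) *
    s^(- (lam - 1) / p), for which the slices of the double integral at fixed s
    are bounded by a constant times w s. *)
Lemma dilation_mean_morrey (p lam A M : R) :
  1 <= p -> (forall s, s <= 0 -> k s = 0) -> 0 < A -> 0 <= M ->
  (\int[lebesgue_measure]_s (k s * s `^ ((lam - 1) / p))%:E <= A%:E)%E ->
  (forall x r, 0 < r -> (\int[lebesgue_measure]_(y in `](x - r)%R, (x + r)%R[)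
     (u y `^ p)%:E <= (M * r `^ lam)%:E)%E) ->
  forall x r, 0 < r -> (\int[lebesgue_measure]_(y in `](x - r)%R, (x + r)%R[)
     (dilation_mean k u y `^ p) <= (A `^ p * M * r `^ lam)%:E)%E.
Proof.
move=> p1 k0 A0 M0 kA uM x r r0; have p0 : 0 < p by lra.
set b := (lam - 1) / p in kA *.
pose w s := k s * s `^ b.
pose v y s := u (s * y) * s `^ (- b).
pose B := `]x - r, x + r[%classic : set R.
have w0 s : 0 <= w s by rewrite mulr_ge0 ?powR_ge0.
have v0 y s : 0 <= v y s by rewrite mulr_ge0 ?powR_ge0.
have mw : measurable_fun [set: R] w.
  exact: measurable_funM mk (measurable_powR b).
have mv y : measurable_fun [set: R] (v y).
  apply: measurable_funM (measurable_powR _).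
  exact: (measurableT_comp mu (mulrr_measurable y)).
pose f (z : R * R) := (\1_B z.1 * (v z.1 z.2 `^ p * w z.2))%:E.
have f0 z : (0 <= f z)%E by rewrite lee_fin !mulr_ge0// powR_ge0.
have mf : measurable_fun [set: R * R] f.
  apply/measurable_EFinP; apply: measurable_funM.
    apply: measurableT_comp measurable_fst.
    by apply: measurable_indic; exact: measurable_itv.
  apply: measurable_funM; last exact: (measurableT_comp mw measurable_snd).
  apply: (measurableT_comp (measurable_powR p)).
  apply: measurable_funM; first exact: (measurableT_comp mu measurable_mulsnd_fst).
  exact: (measurableT_comp (measurable_powR (- b)) measurable_snd).
pose F1 y := (\int[lebesgue_measure]_s f (y, s))%E.
have mF1 : measurable_fun [set: R] F1.
  exact: (@measurable_fun_fubini_tonelli_F _ _ _ _ R lebesgue_measure f mf f0).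
have F1_ge0 y : (0 <= F1 y)%E by apply: integral_ge0.
have mF2 : measurable_fun [set: R] (fun s => \int[lebesgue_measure]_y f (y, s))%E.
  exact: (@measurable_fun_fubini_tonelli_G _ _ _ _ R lebesgue_measure f mf f0).
have jensen y : B y -> (dilation_mean k u y `^ p <=
    (A `^ (p - 1))%:E * F1 y)%E.
  move=> By; rewrite /dilation_mean.
  have -> : (\int[lebesgue_measure]_s (k s * u (s * y))%:E =
      \int[lebesgue_measure]_s (v y s * w s)%:E)%E.
    apply: eq_integral => s _; congr (_%:E); rewrite /v /w.
    have [s0|s0] := leP s 0; first by rewrite k0// !mul0r mulr0.
    by rewrite powRN; field; rewrite gt_eqF ?powR_gt0.
  apply: (le_trans (weighted_jensen p1 A0 (mv y) mw (v0 y) w0 kA)).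
  rewrite le_eqVlt; apply/orP; left; apply/eqP; congr (_ * _)%E.
  by apply: eq_integral => s _; rewrite /f /= indicE mem_set// mul1r.
apply: (@le_trans _ _ ((A `^ (p - 1))%:E *
    \int[lebesgue_measure]_y F1 y)%E).
  have -> : ((A `^ (p - 1))%:E * \int[lebesgue_measure]_y F1 y =
      \int[lebesgue_measure]_y ((A `^ (p - 1))%:E * F1 y))%E.
    have Ap0 : 0 <= A `^ (p - 1) := powR_ge0 _ _.
    have F1p x' : setT x' -> (0 <= F1 x')%E by [].
    apply/esym; exact: (@ge0_integralZl_EFin _ _ _ lebesgue_measure _
      measurableT F1 F1p mF1 _ Ap0).
  rewrite [leLHS]integral_mkcond; apply: ge0_le_integral => //.
  - by move=> y _; rewrite patchE; case: ifPn => // _; exact: poweR_ge0.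
  - apply/(measurable_restrictT _ (measurable_itv _)).
    apply: measurable_funTS; apply: (measurableT_comp (measurable_poweR p)).
    exact: measurable_dilation_mean.
  - exact: measurable_funeM mF1.
  - move=> y _; rewrite patchE; case: ifPn => [/set_mem/jensen//|_].
    by apply: mule_ge0; [rewrite lee_fin powR_ge0|].
rewrite /F1 fubini_tonelli//.
(* Dilating by [s] turns the ball of centre [x] and radius [r] into the one of
   centre [s * x] and radius [s * r]. *)
have slice s : (\int[lebesgue_measure]_y f (y, s) <= (M * r `^ lam * w s)%:E)%E.
  have [s0|s0] := leP s 0.
    by rewrite integral0_eq ?lee_fin ?mulr_ge0 ?powR_ge0// => y _;
      rewrite /f /= /w k0// mul0r !mulr0.
  pose B' := `](s * x) - (s * r), (s * x) + (s * r)[%classic : set R.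
  pose F z := (\1_B' z * u z `^ p)%:E.
  have F0 z : (0 <= F z)%E by rewrite lee_fin mulr_ge0 ?powR_ge0.
  have mFF : measurable_fun [set: R] F.
    apply/measurable_EFinP; apply: measurable_funM.
      by apply: measurable_indic; exact: measurable_itv.
    exact: (measurableT_comp (measurable_powR p)).
  have Fle : (\int[lebesgue_measure]_z F z <= (M * (s * r) `^ lam)%:E)%E.
    apply: le_trans (uM (s * x) (s * r) (mulr_gt0 s0 r0)).
    rewrite [leRHS]integral_mkcond le_eqVlt; apply/orP; left; apply/eqP.
    apply: eq_integral => z _; rewrite patchE /F indicE.
    by case: ifPn; rewrite ?mul1r ?mul0r.
  have -> : (\int[lebesgue_measure]_y f (y, s) =
      \int[lebesgue_measure]_y ((s `^ (- b * p) * w s)%:E * F (s * y)%R))%E.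
    apply: eq_integral => y _; rewrite /F /f /= -EFinM; congr (_%:E).
    have -> : \1_B' (s * y) = \1_B y :> R.
      rewrite !indicE; congr ((nat_of_bool _)%:R); apply/idP/idP;
        rewrite !inE /B /B' /= !in_itv/= -mulrBr -mulrDr !ltr_pM2l//.
    rewrite /v powRM ?powR_ge0// -powRrM; ring.
  rewrite ge0_integralZl_EFin//; last 2 first.
  - exact: (measurableT_comp mFF (mulrl_measurable s)).
  - by rewrite mulr_ge0 ?powR_ge0.
  have -> : (\int[lebesgue_measure]_y F (s * y)%R =
      (s^-1)%:E * \int[lebesgue_measure]_z F z)%E.
    rewrite (ge0_integral_dilation s0 mFF F0) muleA -EFinM mulVf ?mul1e//.
    by rewrite gt_eqF.
  rewrite muleA -EFinM.
  apply: (@le_trans _ _ ((s `^ (- b * p) * w s / s)%:E * (M * (s * r) `^ lam)%:E)%E).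
    by apply: lee_wpmul2l => //; rewrite lee_fin !mulr_ge0 ?powR_ge0 ?invr_ge0// ltW.
  rewrite -EFinM lee_fin (powRM _ (ltW s0) (ltW r0)).
  have -> : - b * p = 1 - lam by rewrite /b; field; lra.
  rewrite powRD ?(gt_eqF s0) ?implybT// (powRr1 (ltW s0)) powRN.
  rewrite le_eqVlt; apply/orP; left; apply/eqP; field.
  by rewrite !gt_eqF ?powR_gt0.
apply: (@le_trans _ _ ((A `^ (p - 1))%:E * (M * r `^ lam * A)%:E)%E); last first.
  rewrite -EFinM lee_fin -(mulr_powRB1 (ltW A0) p0).
  by rewrite le_eqVlt; apply/orP; left; apply/eqP; ring.
apply: lee_wpmul2l; first by rewrite lee_fin powR_ge0.
apply: (@le_trans _ _ (\int[lebesgue_measure]_s ((M * r `^ lam)%:E * (w s)%:E))%E).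
  apply: ge0_le_integral => //.
  - by move=> s _; apply: integral_ge0.
  - by apply: measurable_funeM; apply/measurable_EFinP.
rewrite ge0_integralZl_EFin//; last 3 first.
- by move=> s _; rewrite lee_fin.
- exact/measurable_EFinP.
- by rewrite mulr_ge0 ?powR_ge0.
rewrite [leRHS]EFinM; apply: lee_wpmul2l => //.
by rewrite lee_fin mulr_ge0 ?powR_ge0.
Qed.

End dilation_mean.

(** * Integrals of powers *)

Lemma continuous_powR (R : realType) (c x : R) : 0 < x ->
  {for x, continuous (fun t : R => t `^ c)}.
Proof.
move=> x0; apply: differentiable_continuous; apply/derivable1_diffP.
by apply: derivable_powR; rewrite in_itv/= x0.
Qed.

Lemma integral_powR (R : realType) (c a b : R) : c != 0 -> 0 < a -> a < b ->
  (\int[lebesgue_measure]_(t in `[a, b]) (t `^ (c - 1))%:E =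
   ((b `^ c - a `^ c) / c)%:E)%E.
Proof.
move=> c0 a0 ab.
pose F : R -> R := c^-1 \*: (fun t : R => t `^ c).
have dF (x : R) : 0 < x -> is_derive x (1 : R) F (x `^ (c - 1)).
  move=> x0; have x0' : x \in `]0, +oo[%R by rewrite in_itv/= x0.
  have dp : is_derive x (1 : R) (fun t : R => t `^ c) (c * x `^ (c - 1)).
    by apply: DeriveDef; [exact: derivable_powR|rewrite -derive1E powR_derive1].
  have -> : x `^ (c - 1) = c^-1 *: (c * x `^ (c - 1)).
    by rewrite /GRing.scale/= mulrA mulVf// mul1r.
  exact: is_deriveZ.
have ctsF (x : R) : 0 < x -> {for x, continuous F}.
  move=> x0; apply: differentiable_continuous; apply/derivable1_diffP.
  by have [] := dF x x0.
rewrite (@continuous_FTC2 _ _ F)//.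
- by rewrite -EFinB /F /= /GRing.scale/= -mulrBr mulrC.
- apply: continuous_in_subspaceT => x; rewrite inE/= in_itv/= => /andP[ax _].
  by apply: continuous_powR; lra.
- split.
  + move=> x; rewrite in_itv/= => /andP[ax _].
    by have [] := dF x (lt_trans a0 ax).
  + by apply: cvg_at_right_filter; exact: ctsF.
  + by apply: cvg_at_left_filter; apply: ctsF; lra.
- move=> x; rewrite in_itv/= => /andP[ax _].
  by rewrite derive1E; have [] := dF x (lt_trans a0 ax).
Qed.

(** Monotone convergence, used to reach the singular endpoints 0 and +oo in the
    integrals of powers. *)
Lemma ge0_integral_bigcup_le (R : realType) (F : nat -> set R) (f : R -> R)
    (C : \bar R) :
  {homo F : n m / (n <= m)%N >-> (n <= m)%O} ->
  (forall n, measurable (F n)) -> measurable_fun [set: R] f ->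
  (forall x, 0 <= f x) ->
  (forall n, (\int[lebesgue_measure]_(t in F n) (f t)%:E <= C)%E) ->
  (\int[lebesgue_measure]_(t in \bigcup_n F n) (f t)%:E <= C)%E.
Proof.
move=> ndF mF mf f0 FC.
have mf' : measurable_fun [set: R] (fun t => (f t)%:E) by exact/measurable_EFinP.
have H : (\int[lebesgue_measure]_(t in F n) (f t)%:E @[n --> \oo] -->
    \int[lebesgue_measure]_(t in \bigcup_n F n) (f t)%:E)%E.
  apply: ge0_nondecreasing_set_cvg_integral => //.
  - by move=> n; exact: measurable_funTS.
  - by move=> n x _; rewrite lee_fin.
rewrite -(cvg_lim _ H)//; apply: lime_le; first by apply/cvg_ex; eexists; exact: H.
exact: nearW.
Qed.

Lemma integral_powR0 (R : realType) (c x : R) : 0 < c -> 0 < x ->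
  (\int[lebesgue_measure]_(t in `]0%R, x]) (t `^ (c - 1))%:E <=
   (x `^ c / c)%:E)%E.
Proof.
move=> c0 x0.
pose F n := `[x / n.+2%:R, x]%classic : set R.
have -> : `]0, x]%classic = \bigcup_n F n.
  apply/seteqP; split => t /=; rewrite in_itv/=.
    move=> /andP[t0 tx].
    exists (Num.truncn (x / t)) => //; rewrite /F /= in_itv/= tx andbT.
    rewrite ler_pdivrMr// mulrC -ler_pdivrMr//.
    apply: (le_trans (ltW (truncnS_gt _))).
    by rewrite ler_nat.
  move=> [n _]; rewrite /F /= in_itv/= => /andP[h ->]; rewrite andbT.
  by apply: lt_le_trans h; rewrite divr_gt0.
apply: ge0_integral_bigcup_le.
- move=> n m nm; apply/subsetPset => t; rewrite /F /= !in_itv/= => /andP[h ->].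
  rewrite andbT; apply: le_trans h; rewrite ler_pM2l// lef_pV2 ?posrE//.
  by rewrite ler_nat.
- by move=> n; exact: measurable_itv.
- exact: measurable_powR.
- by move=> t; exact: powR_ge0.
- move=> n; have n0 : 0 < x / n.+2%:R by rewrite divr_gt0.
  rewrite integral_powR ?gt_eqF//; last first.
    by rewrite ltr_pdivrMr// ltr_pMr// ltr1n.
  rewrite lee_fin ler_pM2r ?invr_gt0// gerBl; exact: powR_ge0.
Qed.

Lemma integral_powRy (R : realType) (c x : R) : 0 < c -> 0 < x ->
  (\int[lebesgue_measure]_(t in `]x, +oo[) (t `^ (- c - 1))%:E <=
   (x `^ (- c) / c)%:E)%E.
Proof.
move=> c0 x0.
have mp : measurable_fun [set: R] (fun t : R => t `^ (- c - 1)) by exact: measurable_powR.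
pose F n := `[x, x + n.+1%:R]%classic : set R.
apply: (@le_trans _ _ (\int[lebesgue_measure]_(t in \bigcup_n F n)
    (t `^ (- c - 1))%:E)%E).
  apply: ge0_subset_integral => //.
  - by apply: bigcup_measurable => n _; exact: measurable_itv.
  - by apply: measurable_funTS; apply/measurable_EFinP.
  - by move=> t _; rewrite lee_fin powR_ge0.
  - move=> t /=; rewrite in_itv/= andbT => xt.
    exists (Num.truncn (t - x)) => //; rewrite /F /= in_itv/= ltW//=.
    by rewrite -lerBlDl ltW// truncnS_gt.
apply: ge0_integral_bigcup_le => //.
- move=> n m nm; apply/subsetPset => t; rewrite /F /= !in_itv/= => /andP[-> h].
  by apply: (le_trans h); rewrite lerD2l ler_nat.
- by move=> n; exact: measurable_itv.
- by move=> t; exact: powR_ge0.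
- move=> n; rewrite /F (@integral_powR _ (- c)) ?oppr_eq0 ?gt_eqF//; last by rewrite ltrDl.
  rewrite lee_fin invrN mulrN -mulNr ler_pM2r ?invr_gt0// opprB gerBl.
  exact: powR_ge0.
Qed.

(** * Zygmund conditions and power growth *)

Lemma class_W_measurable (R : realType) (l : R) (phi : R -> R) :
  class_W l phi -> measurable_fun `]0, l] phi.
Proof.
by move=> [cphi _]; apply: subspace_continuous_measurable_fun => //; exact: measurable_itv.
Qed.

Lemma class_W_gt0 (R : realType) (l : R) (phi : R -> R) :
  class_W l phi -> forall x, 0 < x -> x <= l -> 0 < phi x.
Proof. by move=> [_ pos] x x0 xl; apply: pos; rewrite in_itv/= x0. Qed.

Lemma measurable_fun_powRM (R : realType) (l c : R) (phi : R -> R) :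
  measurable_fun `]0, l] phi ->
  measurable_fun `]0, l] (fun x => phi x * x `^ c).
Proof.
move=> mphi; apply: measurable_funM => //.
by apply: measurable_funTS; exact: measurable_powR.
Qed.

(** Growth with exponent c bounds the integrand by a multiple of x^(c-a-1),
    which is integrable at +oo because c < a. *)
Lemma upper_growth_zygmund (R : realType) (l a c : R) (phi : R -> R) :
  class_W l phi -> c < a -> upper_growth l c phi -> zygmund_lower l a phi.
Proof.
move=> W ca [C C0 H]; have ac : 0 < a - c by lra.
have pos := class_W_gt0 W.
exists (C / (a - c)) => h; rewrite in_itv/= => /andP[h0 hl].
pose K := C * phi h * h `^ (- c).
have K0 : 0 <= K by rewrite !mulr_ge0 ?powR_ge0 ?(ltW C0)// ltW// pos// ltW.
have mp : measurable_fun [set: R] (fun x : R => (x `^ (- (a - c) - 1))%:E).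
  by apply/measurable_EFinP; exact: measurable_powR.
have sub : `]h, l[ `<=` `]0, l].
  by move=> x /=; rewrite !in_itv/= => /andP[hx xl]; apply/andP; split; lra.
apply: (@le_trans _ _ (\int[lebesgue_measure]_(x in `]h, l[)
    (K%:E * (x `^ (- (a - c) - 1))%:E))%E).
  apply: ge0_le_integral => //.
  - move=> x /sub/=; rewrite in_itv/= => /andP[x0 xl].
    by rewrite lee_fin divr_ge0 ?powR_ge0// ltW// pos.
  - apply/measurable_EFinP; apply: (measurable_funS (measurable_itv _) sub).
    apply: (eq_measurable_fun (fun x => phi x * x `^ (- (1 + a)))).
      by move=> x _; rewrite powRN.
    by apply: measurable_fun_powRM; exact: class_W_measurable.
  - by apply: measurable_funeM; exact: measurable_funTS.
  - move=> x /=; rewrite in_itv/= => /andP[hx xl]; have x0 : 0 < x by lra.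
    have := H h x h0 (ltW hx) (ltW xl).
    rewrite -EFinM lee_fin ler_pdivrMr ?powR_gt0// => /le_trans; apply.
    rewrite le_eqVlt; apply/orP; left; apply/eqP.
    have -> : x `^ (- (a - c) - 1) = x `^ c / x `^ (1 + a).
      by rewrite -powRB ?(gt_eqF x0) ?implybT//; congr (_ `^ _); ring.
    rewrite /K powR_div ?ltW// powRN.
    by field; rewrite !gt_eqF ?powR_gt0.
rewrite ge0_integralZl_EFin//; last 2 first.
- by move=> x _; rewrite lee_fin powR_ge0.
- exact: measurable_funTS.
apply: (@le_trans _ _ (K%:E * (h `^ (- (a - c)) / (a - c))%:E)%E).
  apply: lee_wpmul2l => //; apply: le_trans (integral_powRy ac h0).
  apply: ge0_subset_integral => //.
  - exact: measurable_funTS.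
  - by move=> x _; rewrite lee_fin powR_ge0.
  - by move=> x /=; rewrite !in_itv/= => /andP[->].
rewrite -EFinM lee_fin le_eqVlt; apply/orP; left; apply/eqP.
rewrite opprB powRD ?(gt_eqF h0) ?implybT// /K !powRN.
by field; rewrite !gt_eqF ?powR_gt0.
Qed.

(** Growth with exponent c bounds the integrand by a multiple of x^(c-b-1),
    which is integrable at 0 because c > b. *)
Lemma lower_growth_zygmund (R : realType) (l b c : R) (phi : R -> R) :
  class_W l phi -> b < c -> lower_growth l c phi -> zygmund_upper l b phi.
Proof.
move=> W bc [C C0 H]; have cb : 0 < c - b by lra.
have pos := class_W_gt0 W.
exists (C / (c - b)) => h; rewrite in_itv/= => /andP[h0 hl].
pose K := C * phi h * h `^ (- c).
have K0 : 0 <= K by rewrite !mulr_ge0 ?powR_ge0 ?(ltW C0)// ltW// pos// ltW.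
have mp : measurable_fun [set: R] (fun x : R => (x `^ (c - b - 1))%:E).
  by apply/measurable_EFinP; exact: measurable_powR.
have sub : `]0, h[ `<=` `]0, l].
  by move=> x /=; rewrite !in_itv/= => /andP[hx xl]; apply/andP; split; lra.
apply: (@le_trans _ _ (\int[lebesgue_measure]_(x in `]0%R, h[)
    (K%:E * (x `^ (c - b - 1))%:E))%E).
  apply: ge0_le_integral => //.
  - move=> x /sub/=; rewrite in_itv/= => /andP[x0 xl].
    by rewrite lee_fin divr_ge0 ?powR_ge0// ltW// pos.
  - apply/measurable_EFinP; apply: (measurable_funS (measurable_itv _) sub).
    apply: (eq_measurable_fun (fun x => phi x * x `^ (- (1 + b)))).
      by move=> x _; rewrite powRN.
    by apply: measurable_fun_powRM; exact: class_W_measurable.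
  - by apply: measurable_funeM; exact: measurable_funTS.
  - move=> x /=; rewrite in_itv/= => /andP[x0 xh].
    have := H x h x0 (ltW xh) (ltW hl).
    rewrite -EFinM lee_fin ler_pdivrMr ?powR_gt0// => /le_trans; apply.
    rewrite le_eqVlt; apply/orP; left; apply/eqP.
    have -> : x `^ (c - b - 1) = x `^ c / x `^ (1 + b).
      by rewrite -powRB ?(gt_eqF x0) ?implybT//; congr (_ `^ _); ring.
    rewrite /K powR_div ?ltW// powRN.
    by field; rewrite !gt_eqF ?powR_gt0.
rewrite ge0_integralZl_EFin//; last 2 first.
- by move=> x _; rewrite lee_fin powR_ge0.
- exact: measurable_funTS.
apply: (@le_trans _ _ (K%:E * (h `^ (c - b) / (c - b))%:E)%E).
  apply: lee_wpmul2l => //; apply: le_trans (integral_powR0 cb h0).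
  apply: ge0_subset_integral => //.
  - exact: measurable_funTS.
  - by move=> x _; rewrite lee_fin powR_ge0.
  - by move=> x /=; rewrite !in_itv/= => /andP[-> /ltW].
rewrite -EFinM lee_fin le_eqVlt; apply/orP; left; apply/eqP.
rewrite powRB ?(gt_eqF h0) ?implybT// /K !powRN.
by field; rewrite !gt_eqF ?powR_gt0.
Qed.

(** Since k g <= F <= c g, the step inequality gives
    F h >= (1 + k / c) F (h t), so F, and with it g, decays geometrically along
    h t^n. The bound T stands for max (t, 1): it keeps all the intermediate
    points h t^i below d both for t = 2 and for t = 1/2. *)
Lemma geometric_halving (R : realType) (t T k c d : R) (F g : R -> R) :
  0 < t -> t <= T -> 1 <= T -> 0 < k -> 0 < c -> 0 < d ->
  (forall h, 0 < h -> h < d -> 0 < g h /\ k * g h <= F h <= c * g h) ->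
  (forall h, 0 < h -> h * T < d -> F (h * t) + k * g (h * t) <= F h) ->
  exists n d', [/\ (0 < n)%N, 0 < d' & forall h, 0 < h -> h < d' ->
    g (h * t ^+ n) <= 2^-1 * g h].
Proof.
move=> t0 tT T1 k0 c0 d0 gF Fstep.
pose q := 1 + k / c.
have kc0 : 0 < k / c by rewrite divr_gt0.
have q1 : 1 < q by rewrite /q; lra.
have T0 : 0 < T by lra.
have geo n h : 0 < h -> h * T ^+ n < d -> q ^+ n * F (h * t ^+ n) <= F h.
  elim: n h => [|n IH] h h0 hd; first by rewrite expr0 mul1r expr0 mulr1.
  have Tn : 1 <= T ^+ n by apply: exprn_ege1.
  have hT : h * T < d.
    apply: le_lt_trans hd; rewrite exprS ler_pM2l// ler_peMr//; exact: ltW.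
  have ht0 : 0 < h * t by rewrite mulr_gt0.
  have htT : h * t * T ^+ n < d.
    apply: le_lt_trans hd; rewrite exprS mulrA ler_pM2r ?exprn_gt0//.
    by rewrite ler_pM2l.
  have htd : h * t < d.
    by apply: le_lt_trans htT; rewrite ler_peMr// ltW.
  have := IH _ ht0 htT; rewrite -mulrA -exprS => h1.
  rewrite exprS -mulrA; apply: (@le_trans _ _ (q * F (h * t))).
    by rewrite ler_pM2l//; lra.
  apply: le_trans (Fstep h h0 hT).
  have [_ /andP[_ h2]] := gF _ ht0 htd.
  rewrite /q mulrDl mul1r lerD2l mulrAC -mulrA ler_pM2l//.
  by rewrite ler_pdivrMr// [_ * c]mulrC.
(* The second entry yields the factor 1/2 for g; the first one forces n > 0. *)
have [n qn] := expr_unbounded (Num.max 2 (2 * c / k)) q1.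
have T1n : 1 <= T ^+ n by apply: exprn_ege1.
have Tn0 : 0 < T ^+ n by lra.
exists n, (d / T ^+ n); split; last first.
- move=> h h0; rewrite ltr_pdivlMr// => hd.
  have tn : t ^+ n <= T ^+ n by apply: lerXn2r => //; rewrite nnegrE ltW.
  have ht0 : 0 < h * t ^+ n by rewrite mulr_gt0 ?exprn_gt0.
  have htd : h * t ^+ n < d by apply: le_lt_trans hd; rewrite ler_pM2l.
  have hd' : h < d by apply: le_lt_trans hd; rewrite ler_peMr// ltW.
  have [g0 /andP[h1 _]] := gF _ ht0 htd.
  have [g0' /andP[_ h2]] := gF _ h0 hd'.
  have h3 := geo n h h0 hd.
  have qn0 : 0 < q ^+ n by rewrite exprn_gt0//; lra.
  have h4 : q ^+ n * (k * g (h * t ^+ n)) <= c * g h.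
    by apply: le_trans h2; apply: le_trans h3; rewrite ler_pM2l.
  have h5 : (2 * c / k) * (k * g (h * t ^+ n)) <= c * g h.
    apply: le_trans h4; rewrite ler_pM2r ?mulr_gt0//.
    by apply: le_trans qn; rewrite le_max lexx orbT.
  have h6 : 2 * c * g (h * t ^+ n) <= c * g h.
    by move: h5; rewrite mulrA divfK// gt_eqF.
  by move: h6; rewrite -mulrA mulrCA ler_pM2l//; lra.
- by rewrite divr_gt0.
- case: n qn {T1n Tn0} => // ; rewrite expr0 => h.
  have : 2 <= Num.max 2 (2 * c / k) by rewrite le_max lexx.
  by move=> /le_trans /(_ h); lra.
Qed.

(** * Zygmund conditions and indices *)

Lemma ge0_integral_cst_le (R : realType) (x y m : R) (psi : R -> R) :
  x <= y -> 0 <= m -> measurable_fun `]x, y[ psi ->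
  (forall t, x < t -> t < y -> m <= psi t) ->
  ((m * (y - x))%:E <= \int[lebesgue_measure]_(t in `]x, y[) (psi t)%:E)%E.
Proof.
move=> xy m0 mpsi H.
apply: (@le_trans _ _ (\int[lebesgue_measure]_(t in `]x, y[) m%:E)%E).
  rewrite integral_cst//= lebesgue_measure_itv/= lte_fin.
  move: xy; rewrite le_eqVlt => /predU1P[->|xy].
    by rewrite subrr mulr0 ltxx mule0.
  by rewrite xy -EFinB -EFinM.
apply: ge0_le_integral => //.
- exact/measurable_EFinP.
- by move=> t /=; rewrite in_itv/= => /andP[? ?]; rewrite lee_fin H.
Qed.

(** On a dyadic interval the integrand is comparable to its value at either
    endpoint. *)
Lemma dyadic_integral_ge (R : realType) (l : R) (psi : R -> R) :
  (forall x, 0 < x -> x <= l -> 0 < psi x) -> comparable_on l psi ->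
  measurable_fun `]0, l] psi ->
  exists2 k : R, 0 < k & forall h, 0 < h -> 2 * h <= l ->
    ((k * (h * psi h))%:E <=
       \int[lebesgue_measure]_(t in `]h, (2 * h)%R[) (psi t)%:E)%E /\
    ((k * (2 * h * psi (2 * h)))%:E <=
       \int[lebesgue_measure]_(t in `]h, (2 * h)%R[) (psi t)%:E)%E.
Proof.
move=> pos /(_ 2)[K K0 HK] mpsi.
exists (2 * K)^-1; first by rewrite invr_gt0; lra.
move=> h h0 hl.
have mh : measurable_fun `]h, 2 * h[ psi.
  apply: measurable_funS mpsi => // t /=; rewrite !in_itv/= => /andP[? ?].
  by apply/andP; split; lra.
have p1 : 0 < psi h by apply: pos; lra.
have p2 : 0 < psi (2 * h) by apply: pos; lra.
split.
- apply: (@le_trans _ _ ((psi h / K * (2 * h - h))%:E)).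
    have : 0 <= h * psi h / K by rewrite divr_ge0 ?mulr_ge0 ?ltW.
    rewrite lee_fin (_ : _^-1 * _ = h * psi h / K / 2); last by field; lra.
    rewrite (_ : psi h / K * _ = h * psi h / K); last by ring.
    by lra.
  apply: ge0_integral_cst_le => //; [lra|by rewrite divr_ge0 ?ltW|].
  move=> t ht t2; rewrite ler_pdivrMr// [_ * K]mulrC.
  by apply: (HK h t _ _ _ _).1; lra.
- apply: (@le_trans _ _ ((psi (2 * h) / K * (2 * h - h))%:E)).
    by rewrite lee_fin le_eqVlt; apply/orP; left; apply/eqP; field; lra.
  apply: ge0_integral_cst_le => //; [lra|by rewrite divr_ge0 ?ltW|].
  move=> t ht t2; rewrite ler_pdivrMr// [_ * K]mulrC.
  by apply: (HK t (2 * h) _ _ _ _).2; lra.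
Qed.

Section zygmund_index.
Context (R : realType) (l a : R) (phi : R -> R).
Hypothesis l_gt0 : 0 < l.
Hypothesis W : class_W l phi.
Hypothesis cphi : comparable_on l phi.

Let psi x : R := phi x / x `^ (1 + a).
Let g x : R := phi x / x `^ a.

Let phi_gt0 := class_W_gt0 W.

Let psi_gt0 x : 0 < x -> x <= l -> 0 < psi x.
Proof. by move=> x0 xl; rewrite divr_gt0 ?powR_gt0 ?phi_gt0. Qed.

Let g_gt0 x : 0 < x -> x <= l -> 0 < g x.
Proof. by move=> x0 xl; rewrite divr_gt0 ?powR_gt0 ?phi_gt0. Qed.

Let gE x : 0 < x -> g x = x * psi x.
Proof.
move=> x0; rewrite /g /psi powRD ?(gt_eqF x0) ?implybT// powRr1 ?ltW//.
by field; rewrite !gt_eqF ?powR_gt0.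
Qed.

Let mpsi : measurable_fun `]0, l] psi.
Proof.
apply: (eq_measurable_fun (fun x => phi x * x `^ (- (1 + a)))).
  by move=> x _; rewrite powRN.
by apply: measurable_fun_powRM; exact: class_W_measurable.
Qed.

Let comparable_psi : comparable_on l psi.
Proof.
have := comparable_on_powR (- (1 + a)) phi_gt0 cphi.
congr (comparable_on l _); apply/funext => x; by rewrite powRN.
Qed.

Let dyadic : exists2 k : R, 0 < k & forall h, 0 < h -> 2 * h <= l ->
    ((k * g h)%:E <=
       \int[lebesgue_measure]_(t in `]h, (2 * h)%R[) (psi t)%:E)%E /\
    ((k * g (2 * h))%:E <=
       \int[lebesgue_measure]_(t in `]h, (2 * h)%R[) (psi t)%:E)%E.
Proof.
have [k k0 H] := dyadic_integral_ge psi_gt0 comparable_psi mpsi.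
by exists k => // h h0 hl; rewrite !gE//; [exact: H|lra].
Qed.

Let mpsiS (A : set R) : measurable A -> A `<=` `]0, l] ->
  measurable_fun A (fun x => (psi x)%:E).
Proof.
by move=> mA Al; apply/measurable_EFinP; apply: measurable_funS mpsi.
Qed.

Let psi_ge0S (A : set R) : A `<=` `]0, l] -> forall x, A x -> (0 <= (psi x)%:E)%E.
Proof.
move=> Al x /Al/=; rewrite in_itv/= => /andP[x0 xl].
by rewrite lee_fin ltW// psi_gt0.
Qed.

Let sub_psi (A B : set R) : measurable A -> measurable B -> A `<=` B ->
  B `<=` `]0, l] -> (\int[lebesgue_measure]_(x in A) (psi x)%:E <=
    \int[lebesgue_measure]_(x in B) (psi x)%:E)%E.
Proof.
move=> mA mB AB Bl; apply: ge0_subset_integral => //; first exact: mpsiS.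
exact: psi_ge0S.
Qed.

Let split_psi (A B C : set R) : measurable A -> measurable B -> measurable C ->
  A `<=` C -> B `<=` C -> C `<=` `]0, l] -> [disjoint A & B] ->
  (\int[lebesgue_measure]_(x in A) (psi x)%:E +
   \int[lebesgue_measure]_(x in B) (psi x)%:E <=
   \int[lebesgue_measure]_(x in C) (psi x)%:E)%E.
Proof.
move=> mA mB mC AC BC Cl dAB.
have ABC : A `|` B `<=` C by move=> x [/AC|/BC].
have ABl := subset_trans ABC Cl.
rewrite -ge0_integral_setU//.
- by apply: sub_psi => //; exact: measurableU.
- by apply: mpsiS => //; exact: measurableU.
- exact: psi_ge0S.
Qed.

Let ratio X h : 0 < h -> h <= l -> 0 < X -> g (h * X) <= 2^-1 * g h ->
  phi (h * X) / phi h <= 2^-1 * X `^ a.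
Proof.
move=> h0 hl X0; have p0 := phi_gt0 h0 hl.
rewrite /g (powRM _ (ltW h0) (ltW X0)) ler_pdivrMr ?mulr_gt0 ?powR_gt0// => H.
rewrite ler_pdivrMr//; apply: (le_trans H).
rewrite le_eqVlt; apply/orP; left; apply/eqP.
by field; rewrite !gt_eqF ?powR_gt0.
Qed.

(** Splitting the integral over (h, l) at 2 h is the step of
    [geometric_halving] with dilation 2. *)
Lemma zygmund_lower_index : zygmund_lower l a phi -> (upper_index phi < a%:E)%E.
Proof.
move=> [c H]; have [k k0 dy] := dyadic.
pose J h := (\int[lebesgue_measure]_(x in `]h, l[) (psi x)%:E)%E.
pose c1 := Num.max c 1.
have c10 : 0 < c1 by rewrite lt_max ltr01 orbT.
have Jle h : 0 < h -> h < l -> (J h <= (c1 * g h)%:E)%E.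
  move=> h0 hl; apply: le_trans (H h _) _; first by rewrite in_itv/= h0.
  by rewrite lee_fin ler_pM2r ?le_max ?lexx// g_gt0// ltW.
have sub h : 0 < h -> `]h, l[%classic `<=` `]0, l]%classic.
  by move=> h0 x /=; rewrite !in_itv/= => /andP[? ?]; apply/andP; split; lra.
have J0 h : 0 < h -> (0 <= J h)%E.
  by move=> h0; apply: integral_ge0; exact: psi_ge0S (sub h h0).
have JE h : 0 < h -> h < l -> (fine (J h))%:E = J h.
  move=> h0 hl; rewrite fineK// ge0_fin_numE ?J0//.
  exact: le_lt_trans (Jle h h0 hl) (ltry _).
have [n [d [n0 d0 Hd]]] : exists n d, [/\ (0 < n)%N, 0 < d & forall h, 0 < h ->
    h < d -> g (h * 2 ^+ n) <= 2^-1 * g h].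
  apply: (@geometric_halving _ 2 2 k c1 (l / 2) (fun h => fine (J h)) g) => //;
    [lra|by rewrite divr_gt0| |].
  - move=> h h0 hl; have hl' : h < l by lra.
    split; first by rewrite g_gt0// ltW.
    rewrite -!lee_fin JE// Jle// andbT.
    apply: (le_trans (dy h h0 _).1); first lra.
    apply: sub_psi => //; last exact: sub.
    by move=> x /=; rewrite !in_itv/= => /andP[-> ?]; lra.
  - move=> h h0 hl; have hl' : h < l by lra.
    have h20 : 0 < h * 2 by lra.
    have h2l : h * 2 < l by lra.
    rewrite -lee_fin EFinD (JE _ h20 h2l) (JE _ h0 hl').
    rewrite [h * 2]mulrC addeC.
    apply: le_trans (@split_psi `]h, 2 * h[%classic `]2 * h, l[%classic
      `]h, l[%classic _ _ _ _ _ _ _) => //.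
    + by apply: leeD2r; apply: (dy h h0 _).2; lra.
    + by move=> x /=; rewrite !in_itv/= => /andP[-> ?]; lra.
    + by move=> x /=; rewrite !in_itv/= => /andP[? ->]; rewrite andbT; lra.
    + exact: sub.
    + apply/disj_setPS => x [] /=; rewrite !in_itv/= => /andP[_ h1] /andP[h2 _].
      by lra.
apply: (@lt_upper_index _ phi (2 ^+ n) a 2^-1 (Num.min d l)).
- by rewrite exprn_egt1 -?lt0n//; lra.
- by lra.
- by lra.
- by rewrite lt_min d0.
- move=> h h0; rewrite lt_min => /andP[hd hl].
  by apply: ratio; rewrite ?exprn_gt0 ?Hd// ltW.
Qed.

(** Splitting the integral over (0, h) at h / 2 is the step of
    [geometric_halving] with dilation 1/2. *)
Lemma zygmund_upper_index : zygmund_upper l a phi -> (a%:E < lower_index phi)%E.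
Proof.
move=> [c H]; have [k k0 dy] := dyadic.
pose J h := (\int[lebesgue_measure]_(x in `]0%R, h[) (psi x)%:E)%E.
pose c1 := Num.max c 1.
have c10 : 0 < c1 by rewrite lt_max ltr01 orbT.
have Jle h : 0 < h -> h < l -> (J h <= (c1 * g h)%:E)%E.
  move=> h0 hl; apply: le_trans (H h _) _; first by rewrite in_itv/= h0.
  by rewrite lee_fin ler_pM2r ?le_max ?lexx// g_gt0// ltW.
have sub h : h < l -> `]0, h[%classic `<=` `]0, l]%classic.
  by move=> h0 x /=; rewrite !in_itv/= => /andP[? ?]; apply/andP; split; lra.
have J0 h : h < l -> (0 <= J h)%E.
  by move=> h0; apply: integral_ge0; exact: psi_ge0S (sub h h0).
have JE h : 0 < h -> h < l -> (fine (J h))%:E = J h.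
  move=> h0 hl; rewrite fineK// ge0_fin_numE ?J0//.
  exact: le_lt_trans (Jle h h0 hl) (ltry _).
have [n [d [n0 d0 Hd]]] : exists n d, [/\ (0 < n)%N, 0 < d & forall h, 0 < h ->
    h < d -> g (h * 2^-1 ^+ n) <= 2^-1 * g h].
  apply: (@geometric_halving _ 2^-1 1 k c1 (l / 2) (fun h => fine (J h)) g) => //;
    [lra|by rewrite divr_gt0| |].
  - move=> h h0 hl; have hl' : h < l by lra.
    split; first by rewrite g_gt0// ltW.
    rewrite -!lee_fin JE// Jle// andbT.
    have h2 : 0 < h / 2 by lra.
    have hE : 2 * (h / 2) = h by lra.
    have := (dy (h / 2) h2 _).2; rewrite hE => /(_ (ltW hl')) /le_trans; apply.
    apply: sub_psi => //; last exact: sub.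
    by move=> x /=; rewrite !in_itv/= => /andP[? ->]; rewrite andbT; lra.
  - move=> h h0; rewrite mulr1 => hl; have h2 : 0 < h / 2 by lra.
    have hE : 2 * (h / 2) = h by lra.
    have hl' : h < l by lra.
    have h2l : h / 2 < l by lra.
    rewrite -lee_fin EFinD (JE _ h2 h2l) (JE _ h0 hl').
    have := (dy (h / 2) h2 _).1; rewrite hE => dy'.
    apply: le_trans (@split_psi `]0, h / 2[%classic `]h / 2, h[%classic
      `]0, h[%classic _ _ _ _ _ _ _) => //.
    + by apply: leeD2l; apply: dy'; lra.
    + by move=> x /=; rewrite !in_itv/= => /andP[-> ?]; lra.
    + by move=> x /=; rewrite !in_itv/= => /andP[? ->]; rewrite andbT; lra.
    + by apply: sub; lra.
    + apply/disj_setPS => x [] /=; rewrite !in_itv/= => /andP[_ h1] /andP[h3 _].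
      by lra.
apply: (@gt_lower_index _ phi (2^-1 ^+ n) a 2^-1 (Num.min d l)).
- by rewrite exprn_gt0//; lra.
- by rewrite exprn_ilt1 -?lt0n//; lra.
- by lra.
- by lra.
- by rewrite lt_min d0.
- move=> h h0; rewrite lt_min => /andP[hd hl].
  by apply: ratio; rewrite ?exprn_gt0 ?Hd// ltW.
Qed.

End zygmund_index.

(** * The Morrey norm in terms of integrals over balls *)

Definition morrey_ball (R : realType) (l x r : R) : set R :=
  [set y : R | y \in `[0%R, l] /\ (`|y - x| < r)%R].

Lemma morrey_ballE (R : realType) (l x r : R) :
  morrey_ball l x r = `](x - r), (x + r)[ `&` `[0, l].
Proof.
apply/seteqP; split => y; rewrite /morrey_ball /= !in_itv/= => -[].
  move=> yl; rewrite ltr_norml => /andP[h1 h2]; split => //.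
  by apply/andP; split; lra.
by move=> /andP[h1 h2] yl; split => //; rewrite ltr_norml; apply/andP; split; lra.
Qed.

Lemma measurable_morrey_ball (R : realType) (l x r : R) :
  measurable (morrey_ball l x r).
Proof. by rewrite morrey_ballE; apply: measurableI; exact: measurable_itv. Qed.

Lemma morrey_norm_le (R : realType) (p lam l N : R) (f : R -> R) :
  1 <= p -> 0 <= N ->
  (forall x r, x \in `[0, l] -> 0 < r ->
    (\int[lebesgue_measure]_(y in morrey_ball l x r) (`|f y| `^ p)%:E <=
     (N `^ p * r `^ lam)%:E)%E) ->
  (morrey_norm p lam l f <= N%:E)%E.
Proof.
move=> p1 N0 H; apply: ge_ereal_sup => _ [x [r [xl r0 ->]]].
set I := (\int[_]_(_ in _) _)%E.
have I0 : (0 <= I)%E by apply: integral_ge0 => y _; rewrite lee_fin powR_ge0.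
have p0 : 0 < p by lra.
have IN : ((r `^ (- lam))%:E * I <= (N `^ p)%:E)%E.
  apply: (@le_trans _ _ ((r `^ (- lam))%:E * (N `^ p * r `^ lam)%:E)%E).
    by apply: lee_wpmul2l; [rewrite lee_fin powR_ge0|exact: H].
  rewrite -EFinM lee_fin powRN mulrCA mulVf ?mulr1//.
  by rewrite gt_eqF// powR_gt0.
have -> : N%:E = ((N `^ p)%:E `^ p^-1)%E.
  by rewrite poweR_EFin -powRrM mulfV ?powRr1// gt_eqF.
apply: gt0_ler_poweR; rewrite ?invr_ge0 ?(ltW p0)//.
  by rewrite in_itv/= leey andbT mule_ge0// lee_fin powR_ge0.
by rewrite in_itv/= leey andbT lee_fin powR_ge0.
Qed.

Lemma morrey_integral_le (R : realType) (p lam l N : R) (f : R -> R) :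
  1 <= p -> (morrey_norm p lam l f <= N%:E)%E ->
  forall x r, x \in `[0, l] -> 0 < r ->
    (\int[lebesgue_measure]_(y in morrey_ball l x r) (`|f y| `^ p)%:E <=
     (N `^ p * r `^ lam)%:E)%E.
Proof.
move=> p1 fN x r xl r0; have p0 : 0 < p by lra.
set I := (\int[_]_(_ in _) _)%E.
have I0 : (0 <= I)%E by apply: integral_ge0 => y _; rewrite lee_fin powR_ge0.
have X0 : (0 <= (r `^ (- lam))%:E * I)%E by rewrite mule_ge0// lee_fin powR_ge0.
have H : (((r `^ (- lam))%:E * I) `^ p^-1 <= N%:E)%E.
  by apply: le_trans fN; apply: ereal_sup_ubound; exists x, r; split.
have : ((((r `^ (- lam))%:E * I) `^ p^-1) `^ p <= N%:E `^ p)%E.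
  apply: gt0_ler_poweR; rewrite ?(ltW p0)//.
    by rewrite in_itv/= leey andbT poweR_ge0.
  by rewrite in_itv/= leey andbT (le_trans _ H)// poweR_ge0.
rewrite -poweRrM mulVf ?gt_eqF// poweRe1// poweR_EFin => {}H.
have rl : 0 < r `^ lam by rewrite powR_gt0.
have -> : I = ((r `^ lam)%:E * ((r `^ (- lam))%:E * I))%E.
  by rewrite muleA -EFinM powRN mulfV ?mul1e// gt_eqF.
rewrite [leRHS]EFinM [leRHS]muleC; apply: lee_wpmul2l => //.
by rewrite lee_fin ltW.
Qed.

Lemma morrey_norm_ge0 (R : realType) (p lam l : R) (f : R -> R) : 0 <= l ->
  (0 <= morrey_norm p lam l f)%E.
Proof.
move=> l0; apply: le_ereal_sup_tmp.
exists (((1 `^ (- lam))%:E *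
  \int[lebesgue_measure]_(y in morrey_ball l 0 1) (`|f y| `^ p)%:E) `^ p^-1)%E.
  by exists 0, 1; split; rewrite ?in_itv/= ?lexx ?l0 ?ltr01.
exact: poweR_ge0.
Qed.

(** Extension by 0 outside [0, l] allows a dilation to move the argument out of
    the interval. *)
Definition extend_abs (R : realType) (l : R) (f : R -> R) : R -> R :=
  (fun z => `|f z|) \_ `[0, l].

Lemma extend_absE (R : realType) (l : R) (f : R -> R) (x : R) :
  0 <= x -> x <= l -> extend_abs l f x = `|f x|.
Proof. by move=> x0 xl; rewrite /extend_abs patchE mem_set//= in_itv/= x0. Qed.

Lemma extend_abs_ge0 (R : realType) (l : R) (f : R -> R) (x : R) :
  0 <= extend_abs l f x.
Proof. by rewrite /extend_abs patchE; case: ifPn. Qed.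

Lemma measurable_extend_abs (R : realType) (l : R) (f : R -> R) :
  measurable_fun `[0, l] f -> measurable_fun [set: R] (extend_abs l f).
Proof.
move=> mf; apply/(measurable_restrictT _ (measurable_itv _)).
exact: (measurableT_comp (@normr_measurable R setT)).
Qed.

(** The balls in the Morrey norm are centred in [0, l]. Moving the centre of an
    arbitrary ball to the nearest point of [0, l] only enlarges its trace on
    [0, l]. *)
Lemma morrey_extend_integral_le (R : realType) (p lam l N : R) (f : R -> R) :
  0 <= l -> 1 <= p -> measurable_fun `[0, l] f ->
  (morrey_norm p lam l f <= N%:E)%E ->
  forall x r, 0 < r ->
    (\int[lebesgue_measure]_(y in `](x - r)%R, (x + r)%R[)
       (extend_abs l f y `^ p)%:E <= (N `^ p * r `^ lam)%:E)%E.
Proof.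
move=> l0 p1 mf fN x r r0; have p0 : 0 < p by lra.
pose x' := Num.max 0 (Num.min x l).
have xl' : x' \in `[0, l].
  by rewrite in_itv/= /x' le_max lexx/= ge_max l0/= ge_min lexx orbT.
have mfp : measurable_fun `[0, l] (fun y => (`|f y| `^ p)%:E).
  apply/measurable_EFinP; apply: (measurableT_comp (measurable_powR p)).
  exact: (measurableT_comp (@normr_measurable R setT)).
apply: le_trans (morrey_integral_le p1 fN xl' r0).
apply: (@le_trans _ _
    (\int[lebesgue_measure]_(y in morrey_ball l x r) (`|f y| `^ p)%:E)%E).
  rewrite morrey_ballE [leLHS]integral_mkcond [leRHS]integral_mkcond.
  rewrite le_eqVlt; apply/orP; left; apply/eqP; apply: eq_integral => y _.
  rewrite !patchE in_setI /extend_abs patchE.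
  by case: (y \in _) => //=; case: (y \in _) => //; rewrite powR0// gt_eqF.
apply: ge0_subset_integral.
- exact: measurable_morrey_ball.
- exact: measurable_morrey_ball.
- apply: measurable_funS mfp; first exact: measurable_itv.
  by rewrite morrey_ballE; exact: subIsetr.
- by move=> y _; rewrite lee_fin powR_ge0.
- move=> y [yl yr]; split => //; move: yl yr xl'.
  rewrite /x' !in_itv/= !ltr_norml => /andP[y0 yl] /andP[h1 h2] _.
  have [xl|xl] := leP x l.
    by have [x0|x0] := leP 0 x; apply/andP; split; lra.
  by rewrite max_r//; apply/andP; split; lra.
Qed.

(** The integral is the difference of the integrals of the positive and negative
    parts, each measurable in the parameter by Tonelli's theorem. *)
Lemma measurable_Rintegral (R : realType) (h : R * R -> R) :
  measurable_fun [set: R * R] h ->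
  measurable_fun [set: R] (fun x => \int[lebesgue_measure]_t (h (x, t))).
Proof.
move=> mh; apply: (measurableT_comp (@fine_measurable R setT measurableT)).
have mh' : measurable_fun [set: R * R] (fun z => (h z)%:E).
  exact/measurable_EFinP.
pose F1 := fubini_F (@lebesgue_measure R) (fun z => (h z)%:E)^\+%E.
pose F2 := fubini_F (@lebesgue_measure R) (fun z => (h z)%:E)^\-%E.
apply: (eq_measurable_fun (fun x => F1 x - F2 x)%E).
  move=> x _; rewrite [RHS]integralE.
  by congr (_ - _)%E; apply: eq_integral => t _; rewrite ?funeposE ?funenegE.
apply: emeasurable_funB.
- apply: measurable_fun_fubini_tonelli_F; first exact: measurable_funepos.
  by move=> z; exact: funepos_ge0.
- apply: measurable_fun_fubini_tonelli_F; first exact: measurable_funeneg.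
  by move=> z; exact: funeneg_ge0.
Qed.

(** * Operators dominated by a homogeneous kernel *)

(** The substitution t = s x turns an average of dilations into an integral
    operator with homogeneous kernel k (t / x) / x. *)
Lemma dilation_meanE (R : realType) (k u : R -> R) (x : R) : 0 < x ->
  measurable_fun [set: R] k -> measurable_fun [set: R] u ->
  (forall s, 0 <= k s) -> (forall s, 0 <= u s) ->
  (\int[lebesgue_measure]_t (k (t / x) * u t)%:E = x%:E * dilation_mean k u x)%E.
Proof.
move=> x0 mk mu k0 u0.
have mf : measurable_fun [set: R] (fun t => (k (t / x) * u t)%:E).
  apply/measurable_EFinP; apply: measurable_funM => //.
  exact: (measurableT_comp mk (mulrr_measurable x^-1)).
rewrite (ge0_integral_dilation x0 mf) => [|t]; last by rewrite lee_fin mulr_ge0.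
congr (_ * _)%E; apply: eq_integral => s _.
by rewrite mulrAC mulfV ?mul1r ?gt_eqF// mulrC [x * s]mulrC mulrC.
Qed.

Lemma lt_pinfty_interval (R : realType) (c d p : R) (g : R -> \bar R) :
  c < d -> 0 < p -> measurable_fun [set: R] g -> (forall x, (0 <= g x)%E) ->
  (\int[lebesgue_measure]_(y in `]c, d[) (g y `^ p) < +oo)%E ->
  exists x, [/\ c < x, x < d & (g x < +oo)%E].
Proof.
move=> cd p0 mg g0 fin; apply: contrapT => H.
have goo y : `]c, d[%classic y -> g y = +oo%E.
  rewrite /= in_itv/= => /andP[cy yd].
  apply: contrapT => gy; apply: H; exists y; split => //.
  by rewrite ltey; apply/eqP.
move: fin; suff -> : (\int[lebesgue_measure]_(y in `]c, d[) (g y `^ p) = +oo)%E.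
  by rewrite ltxx.
have -> : (\int[lebesgue_measure]_(y in `]c, d[) (g y `^ p) =
    \int[lebesgue_measure]_(y in `]c, d[) (cst +oo y))%E.
  apply: eq_integral => y /set_mem/goo ->.
  by rewrite poweRyr// gt_eqF.
rewrite integral_cst//= lebesgue_measure_itv/= lte_fin cd -EFinB.
by rewrite gt0_mulye// lte_fin subr_gt0.
Qed.

(** Both Hardy operators have the form T f x = m x * int_(D x) f t * w t dt with
    a kernel m x * w t bounded by a homogeneous one, (C / x) * k (t / x). The
    hypothesis [k_shift] compares the kernel at x with the kernel at all points
    y of some interval: boundedness makes the dominating average finite almost
    everywhere, hence at one such y, and the comparison carries finiteness over
    to the given x. *)
Section kernel_operator.
Context (R : realType) (l p lam A C : R) (k m w : R -> R) (D : R -> set R).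
Hypothesis l_gt0 : 0 < l.
Hypothesis p_ge1 : 1 <= p.
Hypothesis A_gt0 : 0 < A.
Hypothesis C_gt0 : 0 < C.
Hypothesis k_ge0 : forall s, 0 <= k s.
Hypothesis k_eq0 : forall s, s <= 0 -> k s = 0.
Hypothesis mk : measurable_fun [set: R] k.
Hypothesis k_le : (\int[lebesgue_measure]_s (k s * s `^ ((lam - 1) / p))%:E <= A%:E)%E.
Hypothesis k_shift : forall x, 0 < x -> x <= l -> exists c d, [/\ 0 <= c, c < d &
  forall y, c < y -> y < d ->
    exists B, forall t, k (t / x) <= B * k (t / y)].
Hypothesis mm : measurable_fun `]0, l] m.
Hypothesis m_gt0 : forall x, 0 < x -> x <= l -> 0 < m x.
Hypothesis mw : measurable_fun `]0, l] w.
Hypothesis mD : forall x, measurable (D x).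
Hypothesis mDD : measurable [set z : R * R | D z.1 z.2].
Hypothesis D_sub : forall x, 0 < x -> x <= l -> D x `<=` `]0, l].
Hypothesis dom : forall x t, 0 < x -> x <= l -> D x t ->
  0 <= w t /\ x * (m x * w t) <= C * k (t / x).

Let T (f : R -> R) (x : R) : R :=
  m x * \int[lebesgue_measure]_(t in D x) (f t * w t).

Section fixed_function.
Context (f : R -> R) (N : R).
Hypothesis mf : measurable_fun `[0, l] f.
Hypothesis fN : (morrey_norm p lam l f <= N%:E)%E.

Let u := extend_abs l f.

Let mu : measurable_fun [set: R] u := measurable_extend_abs mf.

Let u_ge0 s : 0 <= u s := extend_abs_ge0 l f s.

Let p_gt0 : 0 < p := lt_le_trans ltr01 p_ge1.

Let mean_morrey x r : 0 < r ->
  (\int[lebesgue_measure]_(y in `](x - r)%R, (x + r)%R[)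
    (dilation_mean k u y `^ p) <= (A `^ p * N `^ p * r `^ lam)%:E)%E.
Proof.
move=> r0; apply: dilation_mean_morrey => //; first exact: powR_ge0.
by move=> y s s0; apply: morrey_extend_integral_le => //; exact: ltW.
Qed.

Let mean_fin x : 0 < x -> x <= l -> (dilation_mean k u x < +oo)%E.
Proof.
move=> x0 xl; have [c [d [c0 cd H]]] := k_shift x0 xl.
have [y [cy yd yfin]] : exists y, [/\ c < y, y < d & (dilation_mean k u y < +oo)%E].
  apply: (@lt_pinfty_interval _ _ _ p) => //.
  - exact: measurable_dilation_mean.
  - by move=> y; exact: dilation_mean_ge0.
  - have r0 : 0 < (d - c) / 2 by lra.
    have := mean_morrey ((c + d) / 2) r0.
    rewrite (_ : (c + d) / 2 - (d - c) / 2 = c); last by lra.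
    rewrite (_ : (c + d) / 2 + (d - c) / 2 = d); last by lra.
    by move=> /le_lt_trans; apply; exact: ltry.
have y0 : 0 < y by lra.
have [B HB] := H y cy yd.
have fin_y : (\int[lebesgue_measure]_t (k (t / y) * u t)%:E < +oo)%E.
  rewrite dilation_meanE// ltey_eq.
  by rewrite fin_numM// ge0_fin_numE//; exact: dilation_mean_ge0.
have mky z : measurable_fun [set: R] (fun t => (k (t / z) * u t)%:E).
  apply/measurable_EFinP; apply: measurable_funM => //.
  exact: (measurableT_comp mk (mulrr_measurable z^-1)).
have fin_x : (\int[lebesgue_measure]_t (k (t / x) * u t)%:E < +oo)%E.
  pose B' := Num.max B 0.
  apply: (@le_lt_trans _ _ (\int[lebesgue_measure]_t
      (B'%:E * (k (t / y) * u t)%:E))%E).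
    apply: ge0_le_integral => //.
    - by move=> t _; rewrite lee_fin mulr_ge0.
    - exact: mky.
    - exact: measurable_funeM (mky y).
    - move=> t _; rewrite -EFinM lee_fin mulrA; apply: ler_wpM2r => //.
      by apply: (le_trans (HB t)); apply: ler_wpM2r => //; rewrite le_max lexx.
  rewrite ge0_integralZl_EFin//; last 3 first.
  - by move=> t _; rewrite lee_fin mulr_ge0.
  - exact: mky.
  - by rewrite le_max lexx orbT.
  rewrite ltey_eq fin_numM// ge0_fin_numE//.
  by apply: integral_ge0 => t _; rewrite lee_fin mulr_ge0.
move: fin_x; rewrite dilation_meanE//.
have := dilation_mean_ge0 k_ge0 u_ge0 x.
case: (dilation_mean k u x) => [z _ _||]//; first exact: ltry.
by rewrite gt0_muley ?lte_fin.
Qed.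

Let mfw : measurable_fun `]0, l] (fun t => f t * w t).
Proof.
apply: measurable_funM => //; apply: measurable_funS mf => //.
by move=> t /=; rewrite !in_itv/= => /andP[/ltW ->].
Qed.

Let integral_dom x : 0 < x -> x <= l ->
  ((m x)%:E * \int[lebesgue_measure]_(t in D x) (`|f t * w t|)%:E <=
    C%:E * dilation_mean k u x)%E.
Proof.
move=> x0 xl; have m0 := m_gt0 x0 xl; have mDx := mD x.
have xm : 0 < x * m x by rewrite mulr_gt0.
have mfa : measurable_fun (D x) (fun t => (`|f t * w t|)%:E).
  apply/measurable_EFinP; apply: (measurableT_comp (@normr_measurable R setT)).
  by apply: measurable_funS mfw => //; exact: D_sub.
have mku : measurable_fun [set: R] (fun t => (k (t / x) * u t)%:E).
  apply/measurable_EFinP; apply: measurable_funM => //.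
  exact: (measurableT_comp mk (mulrr_measurable x^-1)).
rewrite -(@lee_pmul2l _ x%:E)// ?lte_fin// [leRHS]muleCA -dilation_meanE//.
rewrite muleA -EFinM.
have -> : ((x * m x)%:E * \int[lebesgue_measure]_(t in D x) (`|f t * w t|)%:E =
    \int[lebesgue_measure]_(t in D x) ((x * m x)%:E * (`|f t * w t|)%:E))%E.
  by rewrite ge0_integralZl_EFin ?(ltW xm).
have -> : (C%:E * \int[lebesgue_measure]_t (k (t / x) * u t)%:E =
    \int[lebesgue_measure]_t (C%:E * (k (t / x) * u t)%:E))%E.
  rewrite ge0_integralZl_EFin ?(ltW C_gt0)// => t _.
  by rewrite lee_fin mulr_ge0.
apply: (@le_trans _ _ (\int[lebesgue_measure]_(t in D x)
    (C%:E * (k (t / x) * u t)%:E))%E).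
  apply: ge0_le_integral => //.
  - by move=> t _; rewrite -EFinM lee_fin mulr_ge0// ltW.
  - exact: measurable_funeM.
  - by apply: measurable_funTS; exact: measurable_funeM.
  - move=> t Dt; have [w0 h] := dom x0 xl Dt.
    have := D_sub x0 xl Dt; rewrite /= in_itv/= => /andP[t0 tl].
    rewrite -!EFinM lee_fin normrM (ger0_norm w0) /u (extend_absE _ (ltW t0) tl).
    rewrite [leRHS]mulrA [X in _ * X]mulrC mulrA; apply: ler_wpM2r => //.
    by rewrite -mulrA.
apply: ge0_subset_integral => //; first exact: measurable_funeM.
by move=> t _; rewrite -EFinM lee_fin !mulr_ge0// ltW.
Qed.

Lemma kernel_integrable x : 0 < x -> x <= l ->
  lebesgue_measure.-integrable (D x) (fun t => (f t * w t)%:E).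
Proof.
move=> x0 xl; have mDx := mD x; apply/integrableP; split.
  apply/measurable_EFinP; apply: measurable_funS mfw => //; exact: D_sub.
have m0 := m_gt0 x0 xl.
have := integral_dom x0 xl.
under eq_integral do rewrite -abse_EFin.
set I := (\int[_]_(_ in _) _)%E.
have I0 : (0 <= I)%E by apply: integral_ge0.
have := mean_fin x0 xl; have := dilation_mean_ge0 k_ge0 u_ge0 x.
case: (dilation_mean k u x) => [z _ _||]//.
case: I I0 => [i _ _||]//; first by rewrite ltry.
by rewrite gt0_muley ?lte_fin// -EFinM leye_eq.
Qed.

Let kernel_le x : 0 < x -> x <= l ->
  ((`|T f x|)%:E <= C%:E * dilation_mean k u x)%E.
Proof.
move=> x0 xl; apply: le_trans (integral_dom x0 xl).
have m0 := m_gt0 x0 xl; have mDx := mD x.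
rewrite /T normrM (gtr0_norm m0) EFinM; apply: lee_wpmul2l.
  by rewrite lee_fin ltW.
rewrite EFin_normr_Rintegral//; last exact: kernel_integrable.
apply: le_trans (le_abse_integral _ _ _) _ => //.
by apply/measurable_EFinP; apply: measurable_funS mfw => //; exact: D_sub.
Qed.

Let measurable_kernel : measurable_fun `[0, l] (T f).
Proof.
have -> : `[0, l]%classic = [set 0] `|` `]0, l] :> set R.
  apply/seteqP; split => x /=; rewrite !in_itv/=.
    by rewrite le_eqVlt eq_sym => /andP[/orP[/eqP ->|->] ->]; [left|right].
  by move=> [->|/andP[/ltW -> ->]//]; rewrite lexx ltW.
apply/measurable_funU => //; split; first exact: measurable_fun_set1.
pose v := (fun t => f t * w t) \_ `]0, l].
have mv : measurable_fun [set: R] v.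
  by apply/(measurable_restrictT _ (measurable_itv _)).
pose h (z : R * R) := \1_[set z : R * R | D z.1 z.2] z * v z.2.
have mh : measurable_fun [set: R * R] h.
  apply: measurable_funM; first exact: measurable_indic.
  exact: (measurableT_comp mv measurable_snd).
apply: (eq_measurable_fun
    (fun x => m x * \int[lebesgue_measure]_t (h (x, t)))).
  move=> x /set_mem/=; rewrite in_itv/= => /andP[x0 xl].
  rewrite /T [in RHS]Rintegral_mkcond; congr (_ * _).
  apply: eq_Rintegral => t _; rewrite /h indicE /= patchE.
  have [Dt|Dt] := boolP (t \in D x).
    rewrite mem_set ?mul1r; last exact: (set_mem Dt).
    by rewrite /v patchE mem_set//; exact: (D_sub x0 xl (set_mem Dt)).
  rewrite [(x, t) \in _]memNset ?mul0r//= => Dxt.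
  by move: Dt; rewrite mem_set.
apply: measurable_funM => //.
by apply: measurable_funTS; exact: measurable_Rintegral.
Qed.

(** The domination by the average of dilations holds on (0, l] only, so the
    point 0 is removed from the domain of integration. *)
Lemma kernel_morrey_norm_le : 0 <= N ->
  measurable_fun `[0, l] (T f) /\ (morrey_norm p lam l (T f) <= (C * A * N)%:E)%E.
Proof.
move=> N0; split; first exact: measurable_kernel.
have CAN : 0 <= C * A * N by rewrite !mulr_ge0// ltW.
apply: morrey_norm_le => // x r xl r0.
have mT : measurable_fun `[0, l] (fun y => (`|T f y| `^ p)%:E).
  apply/measurable_EFinP; apply: (measurableT_comp (measurable_powR p)).
  exact: (measurableT_comp (@normr_measurable R setT)).
have mball := measurable_morrey_ball l x r.
have sub : morrey_ball l x r `<=` `[0, l] by rewrite morrey_ballE; exact: subIsetr.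
have mg : measurable_fun [set: R] (fun y => (C `^ p)%:E * dilation_mean k u y `^ p)%E.
  apply: measurable_funeM; apply: (measurableT_comp (measurable_poweR p)).
  exact: measurable_dilation_mean.
rewrite -(@integral_setD1 _ _ 0)//; last 2 first.
- by apply: measurableD.
- apply: measurable_funS mT => //; exact: subset_trans (@subDsetl _ _ _) sub.
apply: (@le_trans _ _ (\int[lebesgue_measure]_(y in morrey_ball l x r `\ 0%R)
    ((C `^ p)%:E * dilation_mean k u y `^ p))%E).
  apply: ge0_le_integral => //.
  - by apply: measurableD.
  - apply: measurable_funS mT => //; exact: subset_trans (@subDsetl _ _ _) sub.
  - exact: measurable_funTS.
  - move=> y [[]]; rewrite in_itv/= => /andP[y0 yl] _ /eqP yn0.
    have {}y0 : 0 < y by rewrite lt_neqAle eq_sym yn0.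
    rewrite -poweR_EFin -[(C `^ p)%:E]poweR_EFin -poweRM ?lee_fin ?(ltW C_gt0)//; last first.
      exact: dilation_mean_ge0.
    apply: gt0_ler_poweR; rewrite ?(ltW p_gt0) ?in_itv/= ?leey ?andbT ?lee_fin//.
      by rewrite mule_ge0 ?lee_fin ?(ltW C_gt0)//; exact: dilation_mean_ge0.
    exact: kernel_le.
apply: (@le_trans _ _ (\int[lebesgue_measure]_(y in `](x - r)%R, (x + r)%R[)
    ((C `^ p)%:E * dilation_mean k u y `^ p))%E).
  apply: ge0_subset_integral => //.
  - by apply: measurableD.
  - exact: measurable_funTS.
  - by move=> y _; rewrite mule_ge0 ?lee_fin ?powR_ge0 ?poweR_ge0.
  - by rewrite morrey_ballE => y [[]].
rewrite ge0_integralZl_EFin ?powR_ge0//; last 2 first.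
- by move=> y _; exact: poweR_ge0.
- apply: measurable_funTS; apply: (measurableT_comp (measurable_poweR p)).
  exact: measurable_dilation_mean.
apply: (@le_trans _ _ ((C `^ p)%:E * (A `^ p * N `^ p * r `^ lam)%:E)%E).
  by apply: lee_wpmul2l; [rewrite lee_fin powR_ge0|exact: mean_morrey].
rewrite -EFinM lee_fin !powRM ?mulr_ge0 ?(ltW A_gt0) ?(ltW C_gt0)//.
by rewrite !mulrA.
Qed.

End fixed_function.

Lemma kernel_bounded :
  morrey_bounded p lam l
    (fun f => forall x : R, x \in `]0, l] ->
       lebesgue_measure.-integrable (D x) (fun t => (f t * w t)%:E))
    T.
Proof.
exists (C * A) => f [mf ffin].
have N0 := morrey_norm_ge0 p lam f (ltW l_gt0).
have NE : morrey_norm p lam l f = (fine (morrey_norm p lam l f))%:E.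
  by rewrite fineK// ge0_fin_numE.
have fN : (morrey_norm p lam l f <= (fine (morrey_norm p lam l f))%:E)%E.
  by rewrite -NE.
have [mT TN] := kernel_morrey_norm_le mf fN (fine_ge0 N0).
split.
- by move=> x; rewrite in_itv/= => /andP[x0 xl]; exact: (kernel_integrable mf fN).
- split; first exact: mT.
  by apply: (le_lt_trans TN); rewrite ltry.
- by rewrite NE -EFinM.
Qed.

End kernel_operator.

(** * Boundedness of the two Hardy operators *)

Lemma measurable_itv_inv (R : realType) (l : R) :
  measurable_fun `]0, l] (fun x : R => x^-1).
Proof.
apply: (eq_measurable_fun (fun x : R => x `^ (-1))).
  move=> x /set_mem/=; rewrite in_itv/= => /andP[x0 _].
  by rewrite powR_inv1// ltW.
by apply: measurable_funTS; exact: measurable_powR.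
Qed.

Lemma class_W_measurable_inv (R : realType) (l : R) (phi : R -> R) :
  class_W l phi -> measurable_fun `]0, l] (fun x => (phi x)^-1).
Proof.
move=> W; apply: (eq_measurable_fun (fun x => phi x `^ (-1))).
  move=> x /set_mem/=; rewrite in_itv/= => /andP[x0 xl].
  by rewrite powR_inv1// ltW// (class_W_gt0 W).
exact: (measurableT_comp (measurable_powR _) (class_W_measurable W)).
Qed.

Lemma ge0_powR_itv_integral (R : realType) (I : interval R) (c d : R) (A : \bar R) :
  (\int[lebesgue_measure]_(s in [set` I]) (s `^ (c + d))%:E <= A)%E ->
  [set` I] `<=` `]0, +oo[ ->
  (\int[lebesgue_measure]_s (\1_[set` I] s * s `^ c * s `^ d)%:E <= A)%E.
Proof.
move=> H I0; apply: le_trans H; rewrite [leRHS]integral_mkcond.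
rewrite le_eqVlt; apply/orP; left; apply/eqP; apply: eq_integral => s _.
rewrite patchE indicE; case: ifPn => [/set_mem/I0/=|_]; last by rewrite !mul0r.
rewrite in_itv/= andbT => s0.
by rewrite mul1r powRD// (gt_eqF s0) implybT.
Qed.

(** The kernel is s^(-c) on (0, 1], and
    s^(-c) * s^((lam - 1) / p) = s^(e - 1) is integrable there. Passing from x
    to a larger y costs the factor (y / x)^(-c). *)
Lemma upper_growth_hardy_bounded (R : realType) (l p lam c : R) (phi : R -> R) :
  0 < l -> 1 <= p -> class_W l phi -> c < (lam - 1) / p + 1 ->
  upper_growth l c phi -> hardy_bounded p lam l phi.
Proof.
move=> l0 p1 W ca [C C0 H]; have pos := class_W_gt0 W.
pose k s : R := \1_`]0, 1]%classic s * s `^ (- c).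
pose e := (lam - 1) / p + 1 - c; have e0 : 0 < e by rewrite /e; lra.
have mphi := class_W_measurable W.
apply: (@kernel_bounded R l p lam e^-1 C k (fun x => phi x / x) (fun t => (phi t)^-1)
  (fun x => `]0, x]%classic)) => //.
- by rewrite invr_gt0.
- by move=> s; rewrite mulr_ge0 ?powR_ge0.
- move=> s s0; rewrite /k indicE memNset ?mul0r//= in_itv/= => /andP[s1 _].
  by lra.
- apply: measurable_funM; last exact: measurable_powR.
  by apply: measurable_indic; exact: measurable_itv.
- apply: ge0_powR_itv_integral => [|s /=]; last first.
    by rewrite !in_itv/= => /andP[->].
  have -> : - c + (lam - 1) / p = e - 1 by rewrite /e; ring.
  by apply: le_trans (integral_powR0 e0 ltr01) _; rewrite powR1 mul1r.
(* The dominating average is compared with its value at points to the right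
   of x, possibly beyond l. *)
- move=> x x0 xl; exists x, (x + 1); split; [exact: ltW|lra|].
  move=> y xy _; have y0 : 0 < y by lra.
  exists ((y / x) `^ (- c)) => t; rewrite /k !indicE.
  have [tx|tx] := boolP (t / x \in _); last by rewrite mul0r !mulr_ge0 ?powR_ge0.
  move: tx; rewrite inE/= in_itv/= => /andP[t0 t1].
  have t0' : 0 < t by move: t0; rewrite pmulr_lgt0 ?invr_gt0.
  rewrite mem_set; last first.
    rewrite /= in_itv/= divr_gt0//= ler_pdivrMr// mul1r.
    by move: t1; rewrite ler_pdivrMr// mul1r; lra.
  have -> : t / x = y / x * (t / y) by field; lra.
  by rewrite !mul1r powRM// divr_ge0// ltW.
- apply: measurable_funM => //; exact: measurable_itv_inv.
- by move=> x x0 xl; rewrite divr_gt0// pos.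
- exact: class_W_measurable_inv.
- have -> : [set z : R * R | `]0, z.1]%classic z.2] =
      [set z | 0 < z.2] `&` [set z | z.2 <= z.1].
    by apply/seteqP; split => z /=; rewrite in_itv/= => /andP.
  apply: measurableI; rewrite -[X in measurable X]setTI.
  + have h := measurable_fun_ltr (measurable_cst (0 : R)) (@measurable_snd _ _ R R).
    exact: (h measurableT [set true]).
  + have h := measurable_fun_ler (@measurable_snd _ _ R R) (@measurable_fst _ _ R R).
    exact: (h measurableT [set true]).
- by move=> x x0 xl t /=; rewrite !in_itv/= => /andP[-> tx]; exact: le_trans tx xl.
- move=> x t x0 xl /=; rewrite in_itv/= => /andP[t0 tx].
  have pt : 0 < phi t by apply: pos => //; lra.
  split; first by rewrite invr_ge0 ltW.
  rewrite /k indicE mem_set ?mul1r; last first.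
    by rewrite /= in_itv/= divr_gt0//= ler_pdivrMr// mul1r.
  have -> : x * (phi x / x / phi t) = phi x / phi t by field; lra.
  rewrite ler_pdivrMr//; apply: (le_trans (H t x t0 tx xl)).
  rewrite le_eqVlt; apply/orP; left; apply/eqP.
  by rewrite powRN !powR_div ?ltW// invf_div.
Qed.

(** The kernel is s^(-c-1) on (1, +oo), and
    s^(-c-1) * s^((lam - 1) / p) = s^(-e-1) is integrable there. Passing from x
    to a smaller y costs the factor (y / x)^(-c-1). *)
Lemma lower_growth_dual_hardy_bounded (R : realType) (l p lam c : R)
    (phi : R -> R) :
  0 < l -> 1 <= p -> class_W l phi -> (lam - 1) / p < c ->
  lower_growth l c phi -> dual_hardy_bounded p lam l phi.
Proof.
move=> l0 p1 W bc [C C0 H]; have pos := class_W_gt0 W.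
pose k s : R := \1_`]1, +oo[%classic s * s `^ (- c - 1).
pose e := c - (lam - 1) / p; have e0 : 0 < e by rewrite /e; lra.
have mphi := class_W_measurable W.
apply: (@kernel_bounded R l p lam e^-1 C k phi (fun t => (t * phi t)^-1)
  (fun x => `]x, l]%classic)) => //.
- by rewrite invr_gt0.
- by move=> s; rewrite mulr_ge0 ?powR_ge0.
- move=> s s0; rewrite /k indicE memNset ?mul0r//= in_itv/= andbT => s1.
  by lra.
- apply: measurable_funM; last exact: measurable_powR.
  by apply: measurable_indic; exact: measurable_itv.
- apply: ge0_powR_itv_integral => [|s /=]; last first.
    by rewrite !in_itv/= !andbT; exact: lt_trans.
  have -> : - c - 1 + (lam - 1) / p = - e - 1 by rewrite /e; ring.
  by apply: le_trans (integral_powRy e0 ltr01) _; rewrite powR1 mul1r.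
- move=> x x0 xl; exists 0, x; split => //.
  move=> y y0 yx.
  exists ((y / x) `^ (- c - 1)) => t; rewrite /k !indicE.
  have [tx|tx] := boolP (t / x \in _); last by rewrite mul0r !mulr_ge0 ?powR_ge0.
  move: tx; rewrite inE/= in_itv/= andbT ltr_pdivlMr// mul1r => xt.
  rewrite mem_set; last first.
    by rewrite /= in_itv/= andbT ltr_pdivlMr// mul1r; lra.
  have -> : t / x = y / x * (t / y) by field; lra.
  by rewrite !mul1r powRM// divr_ge0//; lra.
- apply: (eq_measurable_fun (fun t : R => t^-1 * (phi t)^-1)).
    by move=> t _; rewrite invfM.
  by apply: measurable_funM; [exact: measurable_itv_inv|exact: class_W_measurable_inv].
- have -> : [set z : R * R | `]z.1, l]%classic z.2] =
      [set z | z.1 < z.2] `&` [set z | z.2 <= l].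
    by apply/seteqP; split => z /=; rewrite in_itv/= => /andP.
  apply: measurableI; rewrite -[X in measurable X]setTI.
  + have h := measurable_fun_ltr (@measurable_fst _ _ R R) (@measurable_snd _ _ R R).
    exact: (h measurableT [set true]).
  + have h := measurable_fun_ler (@measurable_snd _ _ R R) (measurable_cst (l : R)).
    exact: (h measurableT [set true]).
- move=> x x0 xl t /=; rewrite !in_itv/= => /andP[xt ->].
  by rewrite (lt_trans x0 xt).
- move=> x t x0 xl /=; rewrite in_itv/= => /andP[xt tl].
  have t0 : 0 < t by lra.
  have pt : 0 < phi t by apply: pos.
  split; first by rewrite invr_ge0 mulr_ge0 ?ltW.
  rewrite /k indicE mem_set ?mul1r; last first.
    by rewrite /= in_itv/= andbT ltr_pdivlMr// mul1r.
  rewrite mulrA ler_pdivrMr ?mulr_gt0//.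
  apply: (@le_trans _ _ (x * (C * (x / t) `^ c * phi t))).
    by rewrite ler_pM2l//; apply: H => //; exact: ltW.
  rewrite le_eqVlt; apply/orP; left; apply/eqP.
  have tx0 : 0 < t / x by rewrite divr_gt0.
  rewrite powRB ?(gt_eqF tx0) ?implybT// powRr1 ?(ltW tx0)//.
  rewrite powRN !powR_div ?ltW//.
  by field; rewrite !gt_eqF ?powR_gt0.
Qed.

(** * Necessary conditions *)

(** The integrand is nonincreasing: its part on (0, r] integrates to r^k / k,
    and beyond r it is at most r^(k-1), on a set of measure at most 2 r. *)
Lemma morrey_ball_integral_powR (R : realType) (l x r k : R) :
  0 < k -> k <= 1 -> 0 < r ->
  (\int[lebesgue_measure]_(t in morrey_ball l x r) (t `^ (k - 1))%:E <=
   ((k^-1 + 2) * r `^ k)%:E)%E.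
Proof.
move=> k0 k1 r0.
have mball := measurable_morrey_ball l x r.
have mp : measurable_fun [set: R] (fun t : R => (t `^ (k - 1))%:E).
  by apply/measurable_EFinP; exact: measurable_powR.
pose g t : \bar R := ((fun t : R => (t `^ (k - 1))%:E) \_ `]0, r]) t.
have mg : measurable_fun [set: R] g.
  by apply/(measurable_restrictT _ (measurable_itv _)); exact: measurable_funTS.
have g0 t : (0 <= g t)%E by rewrite /g patchE; case: ifPn; rewrite ?lee_fin ?powR_ge0.
have mball0 : measurable (morrey_ball l x r `\ 0%R) by exact: measurableD.
rewrite -(@integral_setD1 _ _ 0)//; last exact: measurable_funTS.
apply: (@le_trans _ _ (\int[lebesgue_measure]_(t in morrey_ball l x r `\ 0%R)
    (g t + (r `^ (k - 1))%:E))%E).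
  apply: ge0_le_integral => //.
  - by move=> t _; rewrite lee_fin powR_ge0.
  - exact: measurable_funTS.
  - by apply: measurable_funTS; apply: emeasurable_funD.
  - move=> t [[]]; rewrite in_itv/= => /andP[t0 tl] _ /eqP tn0.
    have {}t0 : 0 < t by rewrite lt_neqAle eq_sym tn0.
    have [tr|rt] := leP t r.
      rewrite /g patchE mem_set/= ?in_itv/= ?t0//.
      by rewrite leeDl// lee_fin powR_ge0.
    apply: (@le_trans _ _ (r `^ (k - 1))%:E); last by rewrite leeDr.
    rewrite lee_fin -opprB !powRN lef_pV2 ?posrE ?powR_gt0//.
    by apply: ge0_ler_powR; rewrite ?nnegrE ?subr_ge0// ltW.
apply: (@le_trans _ _ (\int[lebesgue_measure]_(t in `](x - r)%R, (x + r)%R[)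
    (g t + (r `^ (k - 1))%:E))%E).
  apply: ge0_subset_integral => //.
  - by apply: measurable_funTS; apply: emeasurable_funD.
  - by move=> t _; rewrite adde_ge0// lee_fin powR_ge0.
  - by rewrite morrey_ballE => t [[]].
rewrite ge0_integralD//; last 2 first.
- exact: measurable_funTS.
- by move=> t _; rewrite lee_fin powR_ge0.
have -> : (k^-1 + 2) * r `^ k = r `^ k / k + r `^ (k - 1) * ((x + r) - (x - r)).
  have -> : r `^ k = r `^ (k - 1) * r by rewrite mulrC mulr_powRB1// ltW.
  by field; rewrite gt_eqF.
rewrite [leRHS]EFinD; apply: leeD.
  apply: le_trans (integral_powR0 k0 r0).
  rewrite [leRHS]integral_mkcond; apply: ge0_subset_integral => //.
have xr : x - r < x + r by lra.
by rewrite integral_cst//= lebesgue_measure_itv/= lte_fin xr -EFinB -EFinM.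
Qed.

(** The p-th power of the function is t^(k-1) with lam < k <= 1. Its integral
    over a ball of radius r <= l is at most a constant times r^k <=
    l^(k-lam) r^lam; a larger ball has no larger trace on [0, l] than the ball
    of radius l about l / 2. *)
Lemma morrey_powR (R : realType) (p lam l c : R) :
  0 < l -> 1 <= p -> 0 <= lam -> (lam - 1) / p + 1 < c -> c <= 1 ->
  morrey p lam l (fun t => t `^ (c - 1)).
Proof.
move=> l0 p1 lam0 ac c1; have p0 : 0 < p by lra.
split; first by apply: measurable_funTS; exact: measurable_powR.
pose k := (c - 1) * p + 1.
have lamk : lam < k.
  have : (lam - 1) / p < c - 1 by lra.
  by rewrite ltr_pdivrMr// /k; lra.
have k1 : k <= 1.
  have : (c - 1) * p <= 0 by nra.
  by rewrite /k; lra.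
have k0 : 0 < k by lra.
(* The constant of [morrey_ball_integral_powR] times the loss from r^k to r^lam. *)
pose M := (k^-1 + 2) * l `^ (k - lam).
have K0 : 0 < k^-1 + 2 by rewrite addr_gt0 ?invr_gt0//.
have M0 : 0 < M by rewrite mulr_gt0 ?powR_gt0.
have mp (A : set R) : measurable_fun A (fun t : R => (t `^ (k - 1))%:E).
  by apply/measurable_EFinP; apply: measurable_funTS; exact: measurable_powR.
have small x r : 0 < r -> r <= l ->
    (\int[lebesgue_measure]_(t in morrey_ball l x r) (t `^ (k - 1))%:E <=
    (M * r `^ lam)%:E)%E.
  move=> r0 rl; apply: le_trans (morrey_ball_integral_powR l x k0 k1 r0) _.
  rewrite lee_fin /M -mulrA ler_pM2l//.
  have -> : r `^ k = r `^ (k - lam) * r `^ lam.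
    by rewrite -powRD ?(gt_eqF r0) ?implybT// subrK.
  rewrite ler_pM2r ?powR_gt0//.
  by apply: ge0_ler_powR; rewrite ?nnegrE; lra.
apply: (@le_lt_trans _ _ (M `^ p^-1)%:E); last by rewrite ltry.
apply: morrey_norm_le => //; first exact: powR_ge0.
move=> x r xl r0.
rewrite -powRrM mulVf ?gt_eqF// powRr1 ?(ltW M0)//.
have -> : (\int[lebesgue_measure]_(y in morrey_ball l x r)
      (`|y `^ (c - 1)| `^ p)%:E =
    \int[lebesgue_measure]_(t in morrey_ball l x r) (t `^ (k - 1))%:E)%E.
  apply: eq_integral => t _.
  by rewrite ger0_norm ?powR_ge0// -powRrM /k addrK.
have [rl|lr] := leP r l; first exact: small.
apply: (@le_trans _ _
    (\int[lebesgue_measure]_(t in morrey_ball l (l / 2) l) (t `^ (k - 1))%:E)%E).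
  apply: ge0_subset_integral => //; try exact: measurable_morrey_ball.
  - exact: mp.
  - by move=> t _; rewrite lee_fin powR_ge0.
  - move=> t [tl _]; split => //; move: tl; rewrite in_itv/= => /andP[t0 tl].
    by rewrite ltr_norml; apply/andP; split; lra.
apply: le_trans (small _ _ l0 (lexx l)) _.
rewrite lee_fin ler_pM2l//.
by apply: ge0_ler_powR; rewrite ?nnegrE; lra.
Qed.

(** The integral over (0, x] equals the one over (0, 2 x] by dilation, while the
    part over (x, 2 x) is at least 1/2. *)
Lemma integral_inv_pinfty (R : realType) (x : R) : 0 < x ->
  (\int[lebesgue_measure]_(t in `]0%R, x]) (t `^ (- 1))%:E = +oo)%E.
Proof.
move=> x0; apply: contrapT => Jn.
have mp (A : set R) : measurable_fun A (fun t : R => (t `^ (- 1))%:E).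
  by apply/measurable_EFinP; apply: measurable_funTS; exact: measurable_powR.
pose g y (t : R) : \bar R := ((fun t : R => (t `^ (- 1))%:E) \_ `]0, y]) t.
have mg y : measurable_fun [set: R] (g y).
  by apply/(measurable_restrictT _ (measurable_itv _)).
have g0 y t : (0 <= g y t)%E by rewrite /g patchE; case: ifPn; rewrite ?lee_fin ?powR_ge0.
have JE : (\int[lebesgue_measure]_(t in `]0%R, x]) (t `^ (- 1))%:E =
    \int[lebesgue_measure]_(t in `]0%R, (2 * x)%R]) (t `^ (- 1))%:E)%E.
  rewrite [LHS]integral_mkcond [RHS]integral_mkcond.
  have h0 : 0 < 2^-1 :> R by rewrite invr_gt0.
  rewrite (ge0_integral_dilation h0 (mg x) (g0 x)).
  have mg2 : measurable_fun [set: R] (fun t => g x (2^-1 * t)).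
    exact: (measurableT_comp (mg x) (mulrl_measurable _)).
  rewrite -ge0_integralZl_EFin//.
  apply: eq_integral => t _; rewrite /g !patchE.
  have -> : (2^-1 * t \in `]0, x]%classic) = (t \in `]0, 2 * x]%classic).
    apply/idP/idP; rewrite !inE/= !in_itv/= => /andP[h1 h2];
      by apply/andP; split; lra.
  case: ifPn => [|_]; last by rewrite mule0.
  rewrite inE/= in_itv/= => /andP[t0 _]; rewrite -EFinM; congr (_%:E).
  rewrite powRM ?(ltW t0) ?(ltW h0)// powR_inv1 ?(ltW h0)//.
  by rewrite mulrA mulfV ?mul1r// gt_eqF.
have J0 : (0 <= \int[lebesgue_measure]_(t in `]0%R, x]) (t `^ (- 1))%:E)%E.
  by apply: integral_ge0 => t _; rewrite lee_fin powR_ge0.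
have half : ((2^-1)%:E <= \int[lebesgue_measure]_(t in `]x, (2 * x)%R[)
    (t `^ (- 1))%:E)%E.
  have -> : 2^-1 = (2 * x)^-1 * (2 * x - x) :> R by field; lra.
  apply: ge0_integral_cst_le => //; [lra|by rewrite invr_ge0; lra| |].
    by apply: measurable_funTS; exact: measurable_powR.
  by move=> t xt tx; rewrite powR_inv1 ?lef_pV2 ?posrE; lra.
have : (\int[lebesgue_measure]_(t in `]0%R, x]) (t `^ (- 1))%:E + (2^-1)%:E <=
    \int[lebesgue_measure]_(t in `]0%R, (2 * x)%R]) (t `^ (- 1))%:E)%E.
  apply: le_trans (leeD2l _ half) _.
  rewrite -ge0_integral_setU//.
  - apply: ge0_subset_integral => //.
    + exact: measurableU.
    + exact: mp.
    + by move=> t _; rewrite lee_fin powR_ge0.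
    by move=> t [] /=; rewrite !in_itv/= => /andP[h1 h2]; apply/andP; split; lra.
  - exact: mp.
  - by move=> t _; rewrite lee_fin powR_ge0.
  - apply/disj_setPS => t [] /=; rewrite !in_itv/= => /andP[_ h1] /andP[h2 _].
    by lra.
rewrite -JE; move: J0 Jn; case: (\int[_]_(_ in _) _)%E => [z _ _||]//.
by rewrite -EFinD lee_fin; lra.
Qed.

(** If a < c <= 1 and phi has growth c from below, then f t = t^(c-1) is in the
    Morrey space and f t / phi t >= e / t is not integrable at 0. *)
Lemma hardy_bounded_lower_index (R : realType) (l p lam : R) (phi : R -> R) :
  0 < l -> 1 <= p -> 0 <= lam -> lam < 1 -> class_W l phi -> comparable_on l phi ->
  hardy_bounded p lam l phi -> (lower_index phi <= ((lam - 1) / p + 1)%:E)%E.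
Proof.
move=> l0 p1 lam0 lam1 W cphi [K bdd]; have pos := class_W_gt0 W.
have p0 : 0 < p by lra.
have a1 : (lam - 1) / p + 1 < 1.
  by rewrite gtrDr pmulr_llt0 ?invr_gt0//; lra.
rewrite leNgt; apply/negP => /(lower_growth_index l0 pos cphi)[c' ac' Hc'].
pose c := Num.min c' 1.
have ac : (lam - 1) / p + 1 < c by rewrite lt_min ac' a1.
have c1 : c <= 1 by rewrite ge_min lexx orbT.
have [C C0 H] : lower_growth l c phi.
  by apply: lower_growthW Hc' => //; rewrite ge_min lexx.
have [def _ _] := bdd _ (morrey_powR l0 p1 lam0 ac c1).
have /def/integrableP[mint] : l \in `]0, l] by rewrite in_itv/= l0 lexx.
have pl : 0 < phi l by apply: pos.
pose e := l `^ c / (C * phi l).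
have e0 : 0 < e by rewrite divr_gt0 ?powR_gt0 ?mulr_gt0.
have mp : measurable_fun `]0, l] (fun t : R => (t `^ (- 1))%:E).
  by apply/measurable_EFinP; apply: measurable_funTS; exact: measurable_powR.
apply/negP; rewrite -leNgt.
apply: (@le_trans _ _ (\int[lebesgue_measure]_(t in `]0%R, l])
    (e%:E * (t `^ (- 1))%:E))%E).
  rewrite ge0_integralZl_EFin//; last 2 first.
  - by move=> t _; rewrite lee_fin powR_ge0.
  - exact: ltW.
  by rewrite integral_inv_pinfty// gt0_muley// lte_fin.
apply: ge0_le_integral => //.
- by move=> t _; rewrite -EFinM lee_fin mulr_ge0 ?powR_ge0// ltW.
- exact: measurable_funeM.
- exact: measurableT_comp.
- move=> t /=; rewrite in_itv/= => /andP[t0 tl].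
  have pt : 0 < phi t by apply: pos.
  rewrite -EFinM lee_fin ger0_norm ?divr_ge0 ?powR_ge0 ?(ltW pt)//.
  have := H t l t0 tl (lexx l); rewrite powR_div ?(ltW t0) ?(ltW l0)// => h.
  rewrite ler_pdivlMr//.
  apply: (@le_trans _ _ (e * t `^ (- 1) * (C * (t `^ c / l `^ c) * phi l))).
    by rewrite ler_pM2l// mulr_gt0 ?powR_gt0.
  rewrite le_eqVlt; apply/orP; left; apply/eqP.
  rewrite powRD ?(gt_eqF t0) ?implybT// /e.
  by field; rewrite !gt_eqF ?powR_gt0.
Qed.

(** If phi has growth c < b from above, the image of the constant 1 is at least
    e x^c on (0, l / 2]. On balls of radius r about 0 its Morrey quotient is at
    least of order r^(c-b), which is unbounded as r tends to 0. *)
Lemma dual_hardy_bounded_upper_index (R : realType) (l p lam : R) (phi : R -> R) :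
  0 < l -> 1 <= p -> 0 <= lam -> lam < 1 -> class_W l phi -> comparable_on l phi ->
  dual_hardy_bounded p lam l phi -> (((lam - 1) / p)%:E <= upper_index phi)%E.
Proof.
move=> l0 p1 lam0 lam1 W cphi [K bdd]; have pos := class_W_gt0 W.
have p0 : 0 < p by lra.
have b0 : (lam - 1) / p < 0 by rewrite pmulr_llt0 ?invr_gt0//; lra.
rewrite leNgt; apply/negP => /(upper_growth_index l0 pos cphi)[c cb [C C0 H]].
have ac : (lam - 1) / p + 1 < 1 by lra.
have [def [_ fin] _] := bdd _ (morrey_powR l0 p1 lam0 ac (lexx 1)).
pose f (t : R) := t `^ (1 - 1); rewrite -/f in def fin.
have pl : 0 < phi l by apply: pos.
have [B B0 HB] := cphi 2.
pose I0 := (2 * B * phi l)^-1.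
have I00 : 0 < I0 by rewrite invr_gt0 !mulr_gt0.
pose e := phi l * l `^ (- c) / C * I0.
have e0 : 0 < e by rewrite !(mulr_gt0, invr_gt0, powR_gt0).
have low x : 0 < x -> x <= l / 2 -> e * x `^ c <= dual_hardy l phi f x.
  move=> x0 xl2; have xl : x <= l by lra.
  have /def int : x \in `]0, l] by rewrite in_itv/= x0.
  have px : 0 < phi x by apply: pos.
  have mint : measurable_fun `]x, l] (fun t => (f t / (t * phi t))%:E).
    by have /integrableP[] := int.
  have le_int : I0 <= \int[lebesgue_measure]_(t in `]x, l]) (f t / (t * phi t)).
    rewrite -lee_fin fineK; last exact: integrable_fin_num int.
    have sub : `]l / 2, l[ `<=` `]x, l].
      by move=> t /=; rewrite !in_itv/= => /andP[? ?]; apply/andP; split; lra.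
    apply: (@le_trans _ _ (\int[lebesgue_measure]_(t in `](l / 2)%R, l[)
        (f t / (t * phi t))%:E)%E); last first.
      apply: ge0_subset_integral => // t /=; rewrite in_itv/= => /andP[xt tl].
      have t0 : 0 < t by lra.
      by rewrite lee_fin divr_ge0 ?powR_ge0// mulr_ge0 ?ltW// pos.
    have -> : I0 = (l * B * phi l)^-1 * (l - l / 2).
      by rewrite /I0; field; lra.
    apply: ge0_integral_cst_le; [lra| | |].
    - by rewrite invr_ge0 !mulr_ge0 ?ltW.
    - by apply/measurable_EFinP; apply: measurable_funS mint.
    - move=> t lt tl; have t0 : 0 < t by lra.
      have pt : 0 < phi t by apply: pos => //; exact: ltW.
      rewrite /f subrr powRr0 mul1r lef_pV2 ?posrE ?mulr_gt0//.
      rewrite -mulrA; apply: ler_pM; rewrite ?(ltW t0) ?(ltW pt) ?(ltW tl)//.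
      by apply: (HB t l _ _ _ _).1; lra.
  apply: (@le_trans _ _ (phi x * I0)); last by rewrite /dual_hardy ler_pM2l.
  have := H x l x0 xl (lexx l); rewrite powR_div ?(ltW x0) ?(ltW l0)// => h.
  rewrite /e -mulrA [I0 * _]mulrC mulrA ler_pM2r//.
  rewrite mulrAC ler_pdivrMr// powRN mulrAC ler_pdivrMr ?powR_gt0//.
  move: h; rewrite -(ler_pM2r (powR_gt0 c x0)) => /le_trans; apply.
  rewrite le_eqVlt; apply/orP; left; apply/eqP.
  by field; rewrite gt_eqF ?powR_gt0.
pose N := fine (morrey_norm p lam l (dual_hardy l phi f)).
have N0 := morrey_norm_ge0 p lam (dual_hardy l phi f) (ltW l0).
have NE : (morrey_norm p lam l (dual_hardy l phi f) <= N%:E)%E.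
  by rewrite /N fineK// ge0_fin_numE.
have ball := morrey_integral_le p1 NE.
pose th := p * ((lam - 1) / p - c).
have th0 : 0 < th by rewrite mulr_gt0//; lra.
have thE : th = lam - 1 - c * p by rewrite /th; field; lra.
have cp : c * p < 0 by rewrite pmulr_llt0//; lra.
have key r : 0 < r -> r <= l / 2 -> e `^ p <= N `^ p * r `^ th.
  move=> r0 rl.
  have := ball 0 r; rewrite in_itv/= lexx (ltW l0) => /(_ isT r0).
  have mdh : measurable_fun (morrey_ball l 0 r)
      (fun y => (`|dual_hardy l phi f y| `^ p)%:E).
    have [_ [mdh _] _] := bdd _ (morrey_powR l0 p1 lam0 ac (lexx 1)).
    apply/measurable_EFinP; apply: (measurableT_comp (measurable_powR p)).
    apply: (measurableT_comp (@normr_measurable R setT)).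
    apply: measurable_funS mdh => //.
    by rewrite morrey_ballE; exact: subIsetr.
  have sub : `]0, r[ `<=` morrey_ball l 0 r.
    move=> t /=; rewrite in_itv/= => /andP[t0 tr]; split.
      by rewrite in_itv/=; apply/andP; split; lra.
    by rewrite subr0 gtr0_norm.
  move=> h.
  have : ((e `^ p * r `^ (c * p) * (r - 0))%:E <= (N `^ p * r `^ lam)%:E)%E.
    apply: le_trans h.
    apply: (@le_trans _ _ (\int[lebesgue_measure]_(y in `]0%R, r[)
        (`|dual_hardy l phi f y| `^ p)%:E)%E); last first.
      apply: ge0_subset_integral => //; exact: measurable_morrey_ball.
    apply: ge0_integral_cst_le; [exact: ltW| | |].
    - by rewrite mulr_ge0 ?powR_ge0.
    - by apply/measurable_EFinP; apply: measurable_funS mdh => //;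
        exact: measurable_morrey_ball.
    - move=> t t0 tr.
      have tl : t <= l / 2 by lra.
      apply: (@le_trans _ _ ((e * t `^ c) `^ p)).
        rewrite powRM ?(ltW e0) ?powR_ge0// ler_pM2l ?powR_gt0// -powRrM.
        rewrite -[c * p]opprK !(powRN _ (- (c * p))) lef_pV2 ?posrE ?powR_gt0//.
        by apply: ge0_ler_powR; rewrite ?nnegrE; lra.
      have ec : 0 <= e * t `^ c by apply: mulr_ge0; [exact: ltW|exact: powR_ge0].
      apply: ge0_ler_powR; rewrite ?nnegrE ?(ltW p0)//.
      exact: le_trans (low t t0 tl) (ler_norm _).
  rewrite lee_fin subr0 -mulrA.
  have -> : r `^ (c * p) * r = r `^ lam / r `^ th.
    rewrite -powRB ?(gt_eqF r0) ?implybT// -{2}(powRr1 (ltW r0)).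
    rewrite -powRD ?(gt_eqF r0) ?implybT//.
    by congr (_ `^ _); rewrite thE; ring.
  rewrite mulrA ler_pdivrMr ?powR_gt0// => h'.
  have : e `^ p * r `^ lam <= N `^ p * r `^ th * r `^ lam.
    by apply: (le_trans h'); rewrite mulrAC.
  by rewrite ler_pM2r ?powR_gt0.
pose d := e `^ p / (2 * (N `^ p + 1)).
have Np : 0 <= N `^ p := powR_ge0 _ _.
have ep : 0 < e `^ p by rewrite powR_gt0.
have d0 : 0 < d by rewrite divr_gt0//; lra.
(* Chosen so that N^p * r^th <= N^p * d < e^p. *)
pose r := Num.min (l / 2) (d `^ th^-1).
have r0 : 0 < r by rewrite lt_min powR_gt0// divr_gt0.
have rl : r <= l / 2 by rewrite ge_min lexx.
have rd : r `^ th <= d.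
  have -> : d = (d `^ th^-1) `^ th by rewrite -powRrM mulVf ?powRr1 ?gt_eqF// ltW.
  apply: ge0_ler_powR; rewrite ?nnegrE ?powR_ge0 ?(ltW r0) ?(ltW th0)//.
  by rewrite ge_min lexx orbT.
have := key r r0 rl.
have : N `^ p * r `^ th <= N `^ p * d by apply: ler_wpM2l.
have : (2 * (N `^ p + 1)) * d = e `^ p by rewrite /d mulrC divfK//; lra.
by nra.
Qed.

(** * Weighted Hardy operators on Morrey spaces *)

Unset Implicit Arguments.
Set Strict Implicit.

Theorem theorem3p4 (R : realType) (l p lam : R) (p' : \bar R) (phi : R -> R)
    (l_gt0 : 0 < l) (p_ge1 : 1 <= p) (lam_ge0 : 0 <= lam) (lam_lt1 : lam < 1)
    (pp' : ((p%:E)^-1 + p'^-1 = 1)%E)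
    (phi_Wtilde : class_Wtilde l phi)
    (phi_V : class_Vpp l phi \/ class_Vmp l phi) :
  let a : R := lam / p + fine (p'^-1)%E in
  let b : R := lam / p - 1 / p in
  [/\ (zygmund_lower l a phi <-> (upper_index phi < a%:E)%E)
        /\ (zygmund_lower l a phi -> hardy_bounded p lam l phi),
      (zygmund_upper l ((lam - 1) / p) phi <-> (b%:E < lower_index phi)%E)
        /\ (zygmund_upper l ((lam - 1) / p) phi ->
            dual_hardy_bounded p lam l phi),
      hardy_bounded p lam l phi -> (lower_index phi <= a%:E)%E &
      dual_hardy_bounded p lam l phi -> (b%:E <= upper_index phi)%E].
Proof.
have p0 : 0 < p by apply: lt_le_trans p_ge1.
move=> a b.
have bE : b = (lam - 1) / p by rewrite /b mulrBl.
have aE : a = (lam - 1) / p + 1.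
  rewrite /a; have -> : fine (p'^-1)%E = 1 - p^-1; last by ring.
  move: pp'; rewrite inver gt_eqF//.
  case: (p'^-1)%E => [q||]//= [h].
  by apply/eqP; rewrite eq_sym subr_eq addrC h.
rewrite aE bE.
have [W _] := phi_Wtilde.
have pos := class_W_gt0 W.
have cphi := comparable_on_V phi_V.
have upper : zygmund_lower l ((lam - 1) / p + 1) phi ->
    exists2 c, c < (lam - 1) / p + 1 & upper_growth l c phi.
  by move=> /(zygmund_lower_index l_gt0 W cphi); exact: upper_growth_index.
have lower : zygmund_upper l ((lam - 1) / p) phi ->
    exists2 c, (lam - 1) / p < c & lower_growth l c phi.
  by move=> /(zygmund_upper_index l_gt0 W cphi); exact: lower_growth_index.
split.
- split; first split.
  + exact: zygmund_lower_index.
  + move=> /(upper_growth_index l_gt0 pos cphi)[c ca].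
    exact: upper_growth_zygmund.
  + by move=> /upper[c ca]; exact: upper_growth_hardy_bounded.
- split; first split.
  + exact: zygmund_upper_index.
  + move=> /(lower_growth_index l_gt0 pos cphi)[c ca].
    exact: lower_growth_zygmund.
  + by move=> /lower[c ca]; exact: lower_growth_dual_hardy_bounded.
- exact: hardy_bounded_lower_index.
- exact: dual_hardy_bounded_upper_index.
Qed.
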